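(* Let $k$ be a field of characteristic $0$. In the Hopf algebra $k\mathcal T$ of rooted trees, with antipode $S$, let $$\kappa_n=\sum_{t\in\mathcal T_n}\frac{t}{|\mathrm{Symm}(t)|}\in k\mathcal T,$$ and define $\epsilon_n\in k\mathcal T$ inductively by $\epsilon_0=\bullet$ and $$\epsilon_n=\kappa_1\circ\epsilon_{n-1}-\kappa_2\circ\epsilon_{n-2}+\cdots+(-1)^{n-1}\kappa_n .$$ Then the elements $\epsilon_n$ satisfy (a) $\epsilon_n=(-1)^nS(\kappa_n)$; (b) $\phi^*(\epsilon_n)=e_n$, where $e_n$ is the $n$th elementary symmetric function; (c) $n!\,\epsilon_n=t_{1^n}$, where $1^n$ is a string of $n$ ones.
   Context: A rooted tree is a finite poset with a unique maximal element (the root) such that for each element (vertex) $v$ the set of elements exceeding $v$ is a chain; rooted trees are considered up to isomorphism and $|t|$ is the number of vertices. $\mathrm{Symm}(t)$ is the automorphism group of $t$ as a poset. $\mathcal T$ is the set of rooted trees, $\mathcal T_n=\{t\in\mathcal T:|t|=n+1\}$, $k\mathcal T=\bigoplus_{n\ge0}k\mathcal T_n$ is the graded vector space with basis $\mathcal T$, and $\bullet$ is the one-vertex tree. For a forest (commutative monomial) $t_1\cdots t_k$ of rooted trees, $B_+(t_1\cdots t_k)$ is the rooted tree obtained by attaching a new root vertex to each of the roots of $t_1,\dots,t_k$, with $B_+$ of the empty forest equal to $\bullet$. $k\mathcal T$ is a graded connected Hopf algebra (Grossman-Larson): the product is $\circ$, where for $t=B_+(t_1\cdots t_n)$ and $|t'|=m$,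 $t\circ t'$ is the sum of the $m^n$ rooted trees obtained by attaching (the root of) each $t_i$ by a new edge to a vertex of $t'$ ($\bullet$ is the two-sided unit). The coproduct is $\Delta(B_+(t_1\cdots t_k))=\sum B_+(t(I))\otimes B_+(t(J))$, over all ordered pairs $(I,J)$ of disjoint subsets with $I\cup J=\{1,\dots,k\}$, where $t(I)=\prod_{i\in I}t_i$. $\ell_i$ denotes the unbranched rooted tree with $i$ vertices, and for a partition $\lambda=\lambda_1,\dots,\lambda_k$, $t_\lambda=B_+(\ell_{\lambda_1}\cdots\ell_{\lambda_k})$. Let $\mathrm{Sym}$ be the algebra of symmetric functions over $k$, with monomial symmetric functions $m_\lambda$ and $e_n=m_{1^n}$ ($e_0=1$). The linear map $\phi^*:k\mathcal T\to\mathrm{Sym}$ is given on rooted trees by $\phi^*(t)=|\mathrm{Symm}(t_\lambda)|\,m_\lambda$ if $t=t_\lambda$ for some partition $\lambda$, and $\phi^*(t)=0$ otherwise. (It is the Hopf algebra homomorphism dual to the homomorphism $\phi$ from $\mathrm{Sym}$ to the Connes-Kreimer Hopf algebra sending $e_i$ to $\ell_i$.) *)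

(* Defs.v *)
From HB Require Import structures.
From mathcomp Require Import all_boot all_order all_fingroup all_algebra.
From mathcomp Require Import generic_quotient finmap boolp classical_sets functions.
From mathcomp.multinomials Require Import monalg.

Set Implicit Arguments.
Unset Strict Implicit.
Unset Printing Implicit Defensive.

Import GRing.Theory.

Local Open Scope ring_scope.

(* le is a partial order on V with a unique maximal element (the root), in
   which the elements strictly above any vertex form a chain. *)
Record is_rooted_tree (V : finType) (le : rel V) : Prop := IsRootedTree {
  rt_refl : reflexive le;
  rt_anti : antisymmetric le;
  rt_trans : transitive le;
  rt_root : exists! r : V, forall v, le r v -> v = r;
  rt_chain : forall v x y,
    le v x && (x != v) -> le v y && (y != v) -> le x y || le y x
}.

Lemma is_rooted_tree_greatest (V : finType) (le : rel V) :
  reflexive le -> antisymmetric le -> transitive le ->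
  (exists r, forall v, le v r) ->
  (forall v x y, le v x -> le v y -> le x y || le y x) ->
  is_rooted_tree le.
Proof.
move=> lexx anti trans [r rP] chain; split=> //.
  exists r; split=> [v rv|r' r'P]; first by apply: anti; rewrite rv rP.
  by apply: r'P; apply: rP.
by move=> v x y /andP[vx _] /andP[vy _]; apply: chain vx vy.
Qed.

Record treeposet := TreePoset {
  tvert :> finType;
  tle : rel tvert;
  tleP : is_rooted_tree tle
}.

Arguments tle {t} _ _ : rename.

Section TreePosetTheory.
Variable t : treeposet.
Implicit Types v x y : t.

Definition troot : t := projT1 (cid (rt_root (tleP t))).

Lemma tlexx : reflexive (@tle t). Proof. exact: rt_refl (tleP t). Qed.
Lemma tle_anti : antisymmetric (@tle t). Proof. exact: rt_anti (tleP t). Qed.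
Lemma tle_trans : transitive (@tle t). Proof. exact: rt_trans (tleP t). Qed.

Lemma tle_chain v x y : tle v x -> tle v y -> tle x y || tle y x.
Proof.
move=> vx vy; case: (eqVneq x v) vx => [-> _|xv vx]; first by rewrite vy.
case: (eqVneq y v) vy => [-> _|yv vy]; first by rewrite vx orbT.
by apply: (rt_chain (tleP t) (v := v)); rewrite ?vx ?vy.
Qed.

Lemma tle_root v : tle v troot.
Proof.
rewrite /troot; case: cid => r /= [rmax runiq].
case: (@arg_minnP _ v (tle v) (fun w => #|[set x | tle w x]|)).
  exact: tlexx.
move=> w vw wmin; suff -> : r = w by [].
apply: runiq => x wx; apply/eqP; apply: contraT => xw.
have := wmin x (tle_trans vw wx); rewrite leqNgt => /negP[].
apply: proper_card; apply/fintype.properP; split.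
  by apply/fintype.subsetP => y; rewrite !inE; apply: tle_trans.
exists w; rewrite !inE ?tlexx //; apply: contra xw => xw.
by apply/eqP/tle_anti; rewrite xw wx.
Qed.

Definition children : {set t} :=
  [set v | (v != troot) && [forall w, tle v w ==> (w == v) || (w == troot)]].

End TreePosetTheory.

Arguments troot {t}.

Definition child (t : treeposet) : finType := {c : t | c \in children t}.

Definition is_iso (P Q : treeposet) (f : P -> Q) : Prop :=
  bijective f /\ {mono f : x y / tle x y >-> tle x y}.

Definition isomorphic (P Q : treeposet) : Prop := exists f : P -> Q, is_iso f.

Lemma isomorphic_refl P : isomorphic P P.
Proof. by exists id; split=> //; exists id. Qed.

Lemma isomorphic_sym P Q : isomorphic P Q -> isomorphic Q P.
Proof.
move=> [f [[g fK gK] fm]]; exists g; split; first by exists f.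
by move=> x y; rewrite -fm !gK.
Qed.

Lemma isomorphic_trans P Q S : isomorphic P Q -> isomorphic Q S -> isomorphic P S.
Proof.
move=> [f [fb fm]] [g [gb gm]]; exists (g \o f); split; first exact: bij_comp.
by move=> x y /=; rewrite gm fm.
Qed.

Definition Symm (t : treeposet) : {set {perm t}} :=
  [set s : {perm t} | [forall x, forall y, tle (s x) (s y) == tle x y]].

Lemma SymmP (t : treeposet) (s : {perm t}) :
  reflect {mono s : x y / tle x y} (s \in Symm t).
Proof.
rewrite inE; apply: (iffP forallP) => [h x y|h x].
  by have /forallP/(_ y)/eqP := h x.
by apply/forallP => y; rewrite h.
Qed.

Lemma Symm_group_set t : group_set (Symm t).
Proof.
apply/group_setP; split=> [|s u /SymmP hs /SymmP hu]; apply/SymmP => x y.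
  by rewrite !perm1.
by rewrite !permM hu hs.
Qed.

Canonical Symm_group t := Group (Symm_group_set t).

Section Downset.
Variables (t : treeposet) (v : t).

Definition downset_le : rel {u : t | tle u v} := fun x y => tle (val x) (val y).

Lemma downset_leP : is_rooted_tree downset_le.
Proof.
apply: is_rooted_tree_greatest.
- by move=> x; apply: tlexx.
- by move=> x y h; apply/val_inj/tle_anti.
- by move=> y x z; apply: tle_trans.
- by exists (exist _ v (tlexx v)) => -[u uv].
- by move=> u x y; apply: tle_chain.
Qed.

Definition downset : treeposet := TreePoset downset_leP.

End Downset.

(* The poset obtained by attaching the root of each t i by a new edge to the
   vertex f i of t'. *)
Section Attach.
Variables (I : finType) (t : I -> treeposet) (t' : treeposet) (f : I -> t').

Definition attach_le : rel (t' + {i : I & t i})%type := fun x y =>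
  match x, y with
  | inl a, inl b => tle a b
  | inr p, inl b => tle (f (tag p)) b
  | inl _, inr _ => false
  | inr p, inr q => (tag p == tag q) && tle (tagged p) (tagged_as p q)
  end.

Lemma attach_leP : is_rooted_tree attach_le.
Proof.
apply: is_rooted_tree_greatest.
- by move=> [a|[i u]] /=; rewrite ?eqxx ?tagged_asE ?tlexx.
- move=> [a|[i u]] [b|[j w]] //=; first by move/tle_anti => ->.
    by rewrite andbF.
  move=> /andP[/andP[/eqP ij]]; case: j / ij w => w.
  by rewrite !tagged_asE eqxx /= => uw wu; rewrite (tle_anti (introT andP (conj uw wu))).
- move=> [b|[j w]] [a|[i u]] [c|[l z]] //=.
  + exact: tle_trans.
  + exact: tle_trans.
  + by move=> /andP[/eqP ij]; case: j / ij w.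
  + move=> /andP[/eqP ij]; case: j / ij w => w; rewrite tagged_asE => uw.
    move=> /andP[/eqP il]; case: l / il z => z; rewrite !tagged_asE eqxx /=.
    exact: tle_trans.
- by exists (inl troot) => -[a|[i u]] /=; apply: tle_root.
- move=> [v|[i u]] [a|[j w]] [b|[l z]] //=.
  + exact: tle_chain.
  + exact: tle_chain.
  + by move=> ia /andP[/eqP il]; case: l / il z => z _.
  + by move=> /andP[/eqP ij]; case: j / ij w => w _ ->.
  + move=> /andP[/eqP ij]; case: j / ij w => w; rewrite tagged_asE => uw.
    move=> /andP[/eqP il]; case: l / il z => z; rewrite !tagged_asE eqxx /=.
    exact: tle_chain uw.
Qed.

Definition attach : treeposet := TreePoset attach_leP.

End Attach.

Lemma point_leP : is_rooted_tree (fun _ _ : unit => true).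
Proof.
by apply: is_rooted_tree_greatest => //; first move=> [] [].
Qed.

Definition point : treeposet := TreePoset point_leP.

Definition Bplus (I : finType) (t : I -> treeposet) : treeposet :=
  attach (t' := point) t (fun _ => tt).

Lemma ell_leP i : is_rooted_tree (fun x y : 'I_i.-1.+1 => (x <= y)%N).
Proof.
apply: is_rooted_tree_greatest.
- by move=> x; apply: leqnn.
- by move=> x y h; apply/val_inj/anti_leq.
- by move=> y x z; apply: leq_trans.
- by exists ord_max => x; rewrite -ltnS.
- by move=> v x y _ _; apply: leq_total.
Qed.

(* The chain with i vertices; used for i > 0 only. *)
Definition ell (i : nat) : treeposet := TreePoset (ell_leP i).

(* Isomorphism classes: every treeposet is isomorphic to one with vertex set
   'I_n, so the classes form a quotient of a countable type. *)
Definition labelled_tree (n : nat) : Type :=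
  {r : {ffun 'I_n * 'I_n -> bool} | `[< is_rooted_tree (fun x y => r (x, y)) >]}.

HB.instance Definition _ n := Finite.on (labelled_tree n).

Definition labelled_treeposet n (r : labelled_tree n) : treeposet :=
  TreePoset (asboolW (valP r)).

Definition treecode : Type := {n : nat & labelled_tree n}.

HB.instance Definition _ := Choice.on treecode.

Definition decode (c : treecode) : treeposet := labelled_treeposet (tagged c).

Definition code_iso : rel treecode :=
  fun c d => `[< isomorphic (decode c) (decode d) >].

Lemma code_iso_refl : reflexive code_iso.
Proof. by move=> c; apply/asboolP/isomorphic_refl. Qed.

Lemma code_iso_sym : symmetric code_iso.
Proof. by move=> c d; apply/asboolP/asboolP => /isomorphic_sym. Qed.

Lemma code_iso_trans : transitive code_iso.
Proof.
by move=> d c e /asboolP cd /asboolP de; apply/asboolP/(isomorphic_trans cd de).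
Qed.

Canonical code_iso_equiv :=
  EquivRel code_iso code_iso_refl code_iso_sym code_iso_trans.

Definition rtree : Type := {eq_quot code_iso}%qT.

HB.instance Definition _ := Choice.on rtree.

Definition rep (t : rtree) : treeposet := decode (repr (t : {eq_quot code_iso}%qT)).

Coercion rep : rtree >-> treeposet.

Lemma code_isoP (c d : treecode) :
  (c = d %[mod {eq_quot code_iso}])%qT <-> isomorphic (decode c) (decode d).
Proof.
by split=> [/eqmodP/asboolP //|h]; apply/eqmodP/asboolP.
Qed.

Section RtreeOf.
Variable P : treeposet.

Definition encode_rel : {ffun 'I_#|P| * 'I_#|P| -> bool} :=
  [ffun xy => tle (enum_val xy.1) (enum_val xy.2)].

Lemma encode_relP : is_rooted_tree (fun x y => encode_rel (x, y)).
Proof.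
apply: is_rooted_tree_greatest.
- by move=> x; rewrite ffunE tlexx.
- by move=> x y; rewrite !ffunE /= => /tle_anti/enum_val_inj.
- by move=> y x z; rewrite !ffunE; apply: tle_trans.
- by exists (enum_rank troot) => x; rewrite ffunE /= enum_rankK tle_root.
- by move=> v x y; rewrite !ffunE; apply: tle_chain.
Qed.

Definition encode : treecode :=
  Tagged labelled_tree (exist _ encode_rel (asboolT encode_relP)).

Definition rtree_of : rtree := (\pi_({eq_quot code_iso}) encode)%qT.

Lemma decode_encode : isomorphic (decode encode) P.
Proof.
exists (fun x : 'I_#|P| => enum_val x); split; first exact: enum_val_bij.
by move=> x y; rewrite {2}/tle /= ffunE.
Qed.

End RtreeOf.

Lemma rep_rtree_of P : isomorphic (rtree_of P) P.
Proof.
apply: isomorphic_trans (decode_encode P).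
by apply/code_isoP; rewrite reprK.
Qed.

Lemma rtree_of_eq P Q : rtree_of P = rtree_of Q <-> isomorphic P Q.
Proof.
split=> [e|PQ].
  apply: isomorphic_trans (rep_rtree_of Q); rewrite -e.
  exact/isomorphic_sym/rep_rtree_of.
apply/code_isoP.
apply: isomorphic_trans (decode_encode P) (isomorphic_trans PQ _).
exact/isomorphic_sym/decode_encode.
Qed.

Lemma rtree_ofK (t : rtree) : rtree_of t = t.
Proof.
rewrite -[RHS](@reprK _ {eq_quot code_iso}%qT t); apply/code_isoP.
exact: decode_encode.
Qed.

Definition bullet : rtree := rtree_of point.

(* The rooted trees with n + 1 vertices, see in_trees. *)
Definition trees (n : nat) : {fset rtree} :=
  [fset rtree_of (labelled_treeposet r) | r : labelled_tree n.+1]%fset.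

Lemma isomorphic_card (P Q : treeposet) : isomorphic P Q -> #|P| = #|Q|.
Proof. by case=> f [fb _]; apply: bij_eq_card fb. Qed.

Lemma labelled_tree_surj n (P : treeposet) :
  #|P| = n -> exists r : labelled_tree n, isomorphic (labelled_treeposet r) P.
Proof. by move=> e; case: n / e; exists (tagged (encode P)); apply: decode_encode. Qed.

Lemma in_trees n (t : rtree) : (t \in trees n) = (#|t| == n.+1).
Proof.
apply/imfsetP/eqP => [[r _ ->]|e].
  by rewrite (isomorphic_card (rep_rtree_of _)) card_ord.
have [r rt] := labelled_tree_surj e; exists r => //.
by rewrite -[LHS]rtree_ofK; apply/rtree_of_eq/isomorphic_sym.
Qed.

Notation kT k := {malg k[rtree]}.

Section LinearExtension.
Variables (k : fieldType) (B : choiceType) (V : lmodType k) (f : B -> V).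

Definition linext (x : {malg k[B]}) : V := \sum_(b <- msupp x) x@_b *: f b.

Lemma linextEw (d : {fset B}) x :
  (msupp x `<=` d)%fset -> linext x = \sum_(b <- d) x@_b *: f b.
Proof.
move=> le; rewrite /linext (big_fset_incl _ le) // => b _ bx.
by rewrite mcoeff_outdom // scale0r.
Qed.

Fact linext_is_linear : linear linext.
Proof.
move=> a x y; pose d := (msupp x `|` msupp y)%fset.
have dx : (msupp x `<=` d)%fset := fsubsetUl _ _.
have dy : (msupp y `<=` d)%fset := fsubsetUr _ _.
have dxy : (msupp (a *: x + y) `<=` d)%fset.
  apply: fsubset_trans (msuppD_le _ _) (fsetUSS _ (fsubset_refl _)).
  exact: msuppZ_le.
rewrite (linextEw dx) (linextEw dy) (linextEw dxy) scaler_sumr -big_split /=.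
by apply: eq_bigr => b _; rewrite mcoeffD mcoeffZ scalerDl scalerA.
Qed.

HB.instance Definition _ :=
  GRing.isLinear.Build k {malg k[B]} V *:%R linext linext_is_linear.

Lemma linextU b : linext << b >> = f b.
Proof. by rewrite /linext msuppU oner_eq0 big_seq_fset1 mcoeffUU scale1r. Qed.

End LinearExtension.

Section GrossmanLarson.
Variable k : fieldType.

(* For t = B_+(t_1 .. t_n), the t_i are the down-sets of the children of the
   root of t. *)
Definition glT (t t' : rtree) : kT k :=
  \sum_(f : {ffun child t -> t'})
     << rtree_of (attach (fun c : child t => downset (val c)) f) >>.

Definition gl (x y : kT k) : kT k :=
  linext (fun t => linext (fun t' => glT t t') y) x.

(* B_+(t(I)) for t = B_+(t_1 .. t_n). *)
Definition BplusOf (t : rtree) (I : {set child t}) : rtree :=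
  rtree_of (Bplus (fun c : {c : child t | c \in I} => downset (val (val c)))).

(* {malg k[rtree * rtree]} is kT (x) kT, with << (t, t') >> for t (x) t'. *)
Definition coprodT (t : rtree) : {malg k[(rtree * rtree)%type]} :=
  \sum_(I : {set child t}) << (BplusOf I, BplusOf (~: I)) >>.

Definition coprod (x : kT k) : {malg k[(rtree * rtree)%type]} :=
  linext coprodT x.

(* The projection onto degree 0, where << bullet >> spans the component. *)
Definition counit (x : kT k) : k := x@_bullet.

Definition convolution (f g : kT k -> kT k) (x : kT k) : kT k :=
  linext (fun p => gl (f << p.1 >>) (g << p.2 >>)) (coprod x).

Definition is_antipode (S : {linear kT k -> kT k}) : Prop :=
  forall x, convolution S id x = counit x *: << bullet >> /\
            convolution id S x = counit x *: << bullet >>.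

Definition kappa (n : nat) : kT k :=
  \sum_(t <- trees n) (#|Symm (rep t)|%:R)^-1 *: << t >>.

(* epsilons n lists epsilon 0, .., epsilon n; the recursion defining epsilon
   is epsilonS. *)
Fixpoint epsilons (n : nat) : seq (kT k) :=
  if n is m.+1 then
    rcons (epsilons m)
      (\sum_(i < m) (-1) ^+ i *: gl (kappa i.+1) (epsilons m)`_(m - i)
       + (-1) ^+ m *: kappa m.+1)
  else [:: << bullet >>].

Definition epsilon (n : nat) : kT k := (epsilons n)`_n.

Lemma size_epsilons n : size (epsilons n) = n.+1.
Proof. by elim: n => //= n IH; rewrite size_rcons IH. Qed.

Lemma nth_epsilons m n : (n <= m)%N -> (epsilons m)`_n = epsilon n.
Proof.
elim: m => [|m IH]; first by case: n.
rewrite leq_eqVlt => /orP[/eqP -> //|nm].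
by rewrite /= nth_rcons size_epsilons nm IH.
Qed.

Lemma epsilon0 : epsilon 0 = << bullet >>.
Proof. by []. Qed.

Lemma epsilonS n :
  epsilon n.+1 =
    \sum_(i < n) (-1) ^+ i *: gl (kappa i.+1) (epsilon (n - i))
    + (-1) ^+ n *: kappa n.+1.
Proof.
rewrite [LHS]nth_rcons size_epsilons ltnn eqxx.
apply: (f_equal2 +%R); last by [].
have e (i : 'I_n) : (epsilons n)`_(n - i) = epsilon (n - i).
  by rewrite nth_epsilons ?leq_subr.
by apply: eq_bigr => i _; rewrite e.
Qed.

End GrossmanLarson.

Definition is_intpart (s : seq nat) : bool := sorted geq s && (0%N \notin s).

Record intpart := IntPart { parts :> seq nat; _ : is_intpart parts }.

HB.instance Definition _ := [isSub for parts].
HB.instance Definition _ := [Countable of intpart by <:].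

Lemma is_intpart_ones n : is_intpart (nseq n 1%N).
Proof.
apply/andP; split; last by rewrite mem_nseq andbF.
by case: n => //= n; elim: n.
Qed.

Definition ones (n : nat) : intpart := IntPart (is_intpart_ones n).

Definition tpart (l : intpart) : rtree :=
  rtree_of (Bplus (fun i : 'I_(size l) => ell (nth 0%N l i))).

Definition branch_count (P : treeposet) (a : nat) : nat :=
  #|[set c : P | (c \in children P) && (#|[set u | tle u c]| == a)]|.

Lemma isomorphic_branch_count P Q a :
  isomorphic P Q -> branch_count P a = branch_count Q a.
Proof.
move=> [f [fb fm]]; have [g fK gK] := fb.
have fr : f troot = troot.
  by apply: tle_anti; rewrite tle_root -[troot in X in _ && X]gK fm tle_root.
rewrite /branch_count -(card_imset _ (bij_inj fb)); apply: eq_card => y.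
rewrite -[y]gK mem_imset ?inE; last exact: bij_inj.
set x := g y; congr ((_ && _) && _).
- by rewrite -fr (inj_eq (bij_inj fb)).
- apply/forallP/forallP => h w.
    have := h (g w); rewrite -fm -(inj_eq (bij_inj fb) (g w) x).
    by rewrite -(inj_eq (bij_inj fb) (g w) troot) fr gK.
  have := h (f w); rewrite fm (inj_eq (bij_inj fb)).
  by rewrite -fr (inj_eq (bij_inj fb)).
- congr (_ == a); rewrite -(card_imset _ (bij_inj fb)); apply: eq_card => w.
  by rewrite -[w]gK mem_imset ?inE ?fm //; apply: bij_inj.
Qed.

Lemma branch_count_tpart (l : intpart) a : branch_count (tpart l) a = count_mem a l.
Proof.
rewrite (isomorphic_branch_count a (rep_rtree_of _)).
set P := Bplus _; pose T := fun i : 'I_(size l) => ell (nth 0%N l i) : Type.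
pose F := fun i : 'I_(size l) => inr (Tagged T (ord_max : T i)) : P.
have l_gt0 (i : 'I_(size l)) : (0 < nth 0%N l i)%N.
  case/andP: (valP l) => _ l0; rewrite lt0n; apply: contraNneq l0 => <-.
  exact: mem_nth.
have rootP : troot = inl tt :> P.
  by have := tle_root (inl tt : P); case: troot => [[]|].
have F_inj : injective F.
  pose G (v : P) := if v is inr p then Some (tag p) else None.
  by move=> i j e; have /= := congr1 G e; case.
have -> : count_mem a l = #|[set i : 'I_(size l) | nth 0%N l i == a]|.
  rewrite -[in LHS](mkseq_nth 0%N l) count_map -val_enum_ord count_map.
  by rewrite cardsE cardE {2}/enum_mem size_filter enumT.
rewrite -(card_imset _ F_inj); apply: eq_card => v; rewrite !inE rootP.
have downF i : #|[set u | tle u (F i)]| = nth 0%N l i.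
  rewrite -[RHS](prednK (l_gt0 i)) -[RHS]card_ord.
  pose h (u : 'I_(nth 0%N l i).-1.+1) : P :=
    inr (Tagged T (u : T i)).
  have h_inj : injective h.
    by move=> u w e; have /eqP := e; rewrite /eq_op /= eq_Tagged => /eqP.
  rewrite -cardsT -(card_imset _ h_inj); apply: eq_card => w; rewrite !inE.
  apply/idP/imsetP => [|[u _ ->]].
    case: w => [//|[j u]] /andP[/eqP/= ji _]; rewrite /h; case: i / ji {h h_inj}.
    by exists u; rewrite ?inE.
  by rewrite /h /= eqxx tagged_asE /= -ltnS.
apply/idP/imsetP => [/andP[/andP[vr /forallP vc] va]|[i]].
  have [i vF] : exists i, v = F i.
    case: v vr vc {va} => [[]|[i u]] // _ vc; exists i.
    have := vc (F i); rewrite /= eqxx tagged_asE /= -ltnS ltn_ord /= orbF.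
    by move=> /eqP.
  by exists i; rewrite // inE -downF -vF.
rewrite inE -downF => Fa ->; rewrite Fa andbT /=.
apply/forallP => -[[]|[j u]]; apply/implyP => //= /andP[/eqP ij].
case: j / ij u => u; rewrite tagged_asE /= => le.
rewrite orbF; apply/eqP; congr (inr (Tagged _ _)); apply: val_inj => /=.
by apply/eqP; rewrite eqn_leq le -ltnS ltn_ord.
Qed.

Lemma tpart_inj : injective tpart.
Proof.
move=> l m lm; apply: val_inj => /=.
have trans : transitive geq by move=> y x z xy yz; apply: leq_trans yz xy.
have anti : antisymmetric geq by move=> x y; rewrite andbC; apply: anti_leq.
case/andP: (valP l) => ls _; case/andP: (valP m) => ms _.
apply: (sorted_eq trans anti ls ms); apply/allP => a _ /=.
by rewrite -!branch_count_tpart lm.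
Qed.

(* Symmetric functions in variables x_0, x_1, x_2, ... as formal power series
   of bounded degree, given by the function sending a monomial to its
   coefficient. *)
Section SymmetricFunctions.
Variable k : fieldType.
Implicit Types (f g : {cmonom nat} -> k^o) (a b : {cmonom nat}).

Definition is_symfun f : Prop :=
  (forall (s : nat -> nat) a b,
     bijective s -> (forall i, b i = a (s i)) -> f b = f a) /\
  (exists d : nat, forall a, f a != 0 -> (mdeg a <= d)%N).

Definition symfun_pred : {pred {cmonom nat} -> k^o} := fun f => `[< is_symfun f >].

Lemma symfun_submod : submod_closed symfun_pred.
Proof.
split=> [|c f g /asboolP[fs [d fd]] /asboolP[gs [e ge]]]; apply/asboolP; split.
- by [].
- by exists 0%N => a; rewrite eqxx.
- by move=> s a b sb ab; rewrite /GRing.add/= /GRing.scale/= (fs s a b) ?(gs s a b).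
- exists (maxn d e) => a; apply: contraNT; rewrite leq_max negb_or => /andP[da ea].
  have fa0 : f a = 0 by apply/eqP; apply: contraNT da; apply: fd.
  have ga0 : g a = 0 by apply/eqP; apply: contraNT ea; apply: ge.
  by rewrite /GRing.add/= /GRing.scale/= fa0 ga0 scaler0 addr0.
Qed.

HB.instance Definition _ := GRing.isSubmodClosed.Build k _ symfun_pred symfun_submod.

Record Sym := MkSym { symcoef : {cmonom nat} -> k^o; _ : symcoef \in symfun_pred }.

HB.instance Definition _ := [isSub for symcoef].
HB.instance Definition _ := [Choice of Sym by <:].
HB.instance Definition _ := [SubChoice_isSubLmodule of Sym by <:].

Definition exponents a : seq nat := [seq a i | i <- finsupp a].

(* m_l is the sum of the monomials whose nonzero exponents are the parts of l
   in some order. *)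
Definition msymf_coef (l : intpart) a : k^o := (perm_eq (exponents a) l)%:R.

Lemma msymf_symfun l : msymf_coef l \in symfun_pred.
Proof.
apply/asboolP; split=> [s a b [s' sK s'K] ab|].
  rewrite /msymf_coef; congr ((nat_of_bool _)%:R).
  suff /permPl-> : perm_eq (exponents b) (exponents a) by [].
  have -> : exponents b = [seq a i | i <- [seq s i | i <- finsupp b]].
    by rewrite -map_comp; apply: eq_map => i; rewrite ab.
  apply: perm_map; apply: uniq_perm; rewrite ?fset_uniq //.
    by rewrite map_inj_uniq ?fset_uniq //; apply: can_inj sK.
  move=> i; rewrite mem_finsupp; apply/mapP/idP => [[j]|ai].
    by rewrite mem_finsupp ab => aj ->.
  by exists (s' i); rewrite ?s'K // mem_finsupp ab s'K.
exists (sumn l) => a; rewrite /msymf_coef -[_%:R]/((if _ then 1%N else 0%N)%:R).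
case: ifP => [al _|]; last by rewrite eqxx.
have -> : mdeg a = sumn (exponents a) by rewrite /mdeg sumnE big_map.
by rewrite (perm_sumn al).
Qed.

Definition msymf (l : intpart) : Sym := MkSym (msymf_symfun l).

Definition esymf (n : nat) : Sym := msymf (ones n).

Definition phistarT (t : rtree) : Sym :=
  if pselect (exists l, t = tpart l) is left ex
  then let l := projT1 (cid ex) in #|Symm (tpart l)|%:R *: msymf l
  else 0.

Lemma phistarT_tpart l : phistarT (tpart l) = #|Symm (tpart l)|%:R *: msymf l.
Proof.
rewrite /phistarT; case: pselect => [ex|[]]; last by exists l.
by case: (cid ex) => m /= /tpart_inj <-.
Qed.

Lemma phistarT_eq0 t : ~ (exists l, t = tpart l) -> phistarT t = 0.
Proof. by rewrite /phistarT; case: pselect. Qed.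

Definition phistar (x : kT k) : Sym := linext phistarT x.

End SymmetricFunctions.

(* Main.v *)
Require Import Defs.
From HB Require Import structures.
From mathcomp Require Import all_boot all_fingroup all_algebra.
From mathcomp Require Import finmap boolp.
From mathcomp.multinomials Require Import monalg.

(* A tree with n + 1 vertices is a forest order on the n non-root vertices, and
   each tree t arises from n!/|Symm t| forest orders r on a fixed n-element set,
   so kappa_n = (1/n!) sum_r [r].  Over labelled forests the automorphisms
   disappear: choosing a set of branches of a forest on T amounts to choosing
   U with T - U and a forest on each, so kappa is a sequence of divided powers,
   Delta kappa_n = sum_i kappa_i (x) kappa_(n-i); and attaching the branches of
   a tree to the corolla t_(1^m) produces the forests in which m prescribed
   vertices are children of the root (the remaining order is recovered by
   restriction), so kappa_(n-m) o t_(1^m)/m! = (1/n!) sum_r C(d(r), m) [r],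
   where d(r) is the number of children of the root.  The alternating sum of
   the binomials C(d, m) shows that t_(1^n)/n! satisfies the recursion defining
   epsilon_n, which gives (c) and then (b); applying id * S to kappa_n shows
   that (-1)^n S(kappa_n) satisfies it as well, which gives (a). *)

Set Implicit Arguments.
Unset Strict Implicit.
Unset Printing Implicit Defensive.

Import GRing.Theory.
Local Open Scope ring_scope.

(** * Isomorphisms of tree posets and the children of the root *)

Lemma mono_inj_tree (P Q : treeposet) (f : P -> Q) :
  {mono f : x y / tle x y >-> tle x y} -> injective f.
Proof. by move=> fm x y e; apply: tle_anti; rewrite -!fm e !tlexx. Qed.

Lemma surj_mono_isomorphic (P Q : treeposet) (f : P -> Q) :
  {mono f : x y / tle x y >-> tle x y} -> (forall y, exists x, f x = y) ->
  isomorphic P Q.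
Proof.
move=> fm fs; exists f; split=> //.
have [g fK] := choice fs.
by exists g => // x; apply: (mono_inj_tree fm); rewrite fK.
Qed.

Lemma iso_root (P Q : treeposet) (f : P -> Q) : is_iso f -> f troot = troot.
Proof.
move=> [[g fK gK] fm]; apply: tle_anti.
by rewrite tle_root -[troot in X in _ && X]gK fm tle_root.
Qed.

Lemma childP (P : treeposet) (c : P) :
  reflect (c <> troot /\ forall w, tle c w -> w = c \/ w = troot)
          (c \in children P).
Proof.
rewrite inE; apply: (iffP andP) => [[/eqP cr /forallP h]|[/eqP cr h]]; split=> //.
  by move=> w cw; have := h w; rewrite cw => /orP[] /eqP; [left|right].
apply/forallP => w; apply/implyP => /h.
by move=> [] ->; rewrite eqxx ?orbT.
Qed.

Lemma iso_child (P Q : treeposet) (f : P -> Q) c :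
  is_iso f -> (f c \in children Q) = (c \in children P).
Proof.
move=> fi; have fr := iso_root fi; have [[g fK gK] fm] := fi.
have finj := can_inj fK.
apply/childP/childP => -[cr h]; split.
- by move=> e; apply: cr; rewrite e.
- by move=> w cw; have := h (f w); rewrite fm -fr => /(_ cw)[] /finj; [left|right].
- by rewrite -fr => /finj.
- move=> w; rewrite -[w]gK fm -fr => /h[] ->; [by left|by right].
Qed.

(** Among the non-root vertices above [v], one with the fewest vertices above it works: a vertex
    strictly between it and the root would have fewer. *)
Lemma ex_child (P : treeposet) (v : P) :
  v <> troot -> exists2 c, c \in children P & tle v c.
Proof.
move=> vr; pose D x := tle v x && (x != troot).
have Dv : D v by rewrite /D tlexx; apply/eqP.
case: (@arg_minnP _ v D (fun w => #|[set x | tle w x]|) Dv).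
move=> c /andP[vc /eqP cr] cmin; exists c => //; apply/childP; split=> // w cw.
case: (eqVneq w troot) => [->|wr]; [by right|left].
apply/eqP; apply: contraT => wc.
have := cmin w; rewrite /D (tle_trans vc cw) wr => /(_ isT).
rewrite leqNgt => /negP[].
apply: proper_card; apply/fintype.properP; split.
  by apply/fintype.subsetP => y; rewrite !inE; apply: tle_trans.
exists c; rewrite !inE ?tlexx //; apply: contra wc => wc.
by apply/eqP/tle_anti; rewrite wc cw.
Qed.

(** Both children lie above [v], hence are comparable, and strictly above a child there is only the
    root. With [ex_child], the down-sets of the children partition the non-root vertices. *)
Lemma child_uniq (P : treeposet) (v c d : P) :
  c \in children P -> d \in children P -> tle v c -> tle v d -> c = d.
Proof.
move=> /childP[cr hc] /childP[dr hd] vc vd.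
by case/orP: (tle_chain vc vd) => [/hc|/hd] [].
Qed.

Lemma child_nroot (P : treeposet) (c u : P) :
  c \in children P -> tle u c -> u <> troot.
Proof.
move=> /childP[cr _] uc ur; apply: cr; apply: tle_anti.
by rewrite tle_root -ur uc.
Qed.

Lemma downset_iso (P Q : treeposet) (f : P -> Q) v :
  is_iso f -> isomorphic (downset v) (downset (f v)).
Proof.
move=> [[g fK gK] fm].
have fd (u : downset v) : tle (f (val u)) (f v) by rewrite fm; apply: (valP u).
pose F (u : downset v) : downset (f v) := exist _ (f (val u)) (fd u).
apply: (@surj_mono_isomorphic _ _ F) => [x y|[y yv]]; first exact: fm.
have gy : tle (g y) v by rewrite -fm gK.
by exists (exist _ (g y) gy); apply: val_inj; rewrite /= gK.
Qed.

Lemma attach_iso (I J : finType) (t : I -> treeposet) (s : J -> treeposet)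
    (t' s' : treeposet) (f : I -> t') (g : J -> s') (h : I -> J) (psi : t' -> s') :
  bijective h -> is_iso psi -> (forall i, isomorphic (t i) (s (h i))) ->
  (forall i, psi (f i) = g (h i)) -> isomorphic (attach t f) (attach s g).
Proof.
move=> hb [psib psim] ts fg; have [h' hK h'K] := hb; have [psi' pK p'K] := psib.
pose phi i := sval (cid (ts i)).
have phiP i : is_iso (phi i) := svalP (cid (ts i)).
pose F (x : attach t f) : attach s g :=
  match x with
  | inl a => inl (psi a)
  | inr p => inr (Tagged s (phi (tag p) (tagged p)))
  end.
apply: (@surj_mono_isomorphic _ _ F).
  move=> [a|[i u]] [b|[j w]] //=.
    by rewrite -(psim (f i)) fg.
  rewrite (inj_eq (can_inj hK)); case: eqVneq => //= ij.
  by case: j / ij w => w; rewrite !tagged_asE; apply: (phiP i).2.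
move=> [b|[j w]]; first by exists (inl (psi' b)); rewrite /= p'K.
(* Writing [j] as [h (h' j)] puts [w] in the target of the isomorphism chosen for the branch
   [h' j]. *)
rewrite -(h'K j) in w *; have [[phi' _ pK'] _] := phiP (h' j).
by exists (inr (Tagged t (phi' w))); rewrite /= pK'.
Qed.

Lemma rtree_of_iso P Q : isomorphic P Q -> rtree_of P = rtree_of Q.
Proof. by move/rtree_of_eq. Qed.

Lemma iso_child_bij (P Q : treeposet) (f : P -> Q) :
  is_iso f -> exists2 h : child P -> child Q,
    bijective h & forall c, val (h c) = f (val c).
Proof.
move=> fi; have [[g fK gK] fm] := fi.
have hP (c : child P) : f (val c) \in children Q by rewrite iso_child ?(valP c).
have kP (d : child Q) : g (val d) \in children P.
  by rewrite -(iso_child _ fi) gK (valP d).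
exists (fun c => exist _ (f (val c)) (hP c)) => //.
by exists (fun d => exist _ (g (val d)) (kP d)) => x; apply: val_inj; rewrite /= ?fK ?gK.
Qed.

(** * Product and coproduct computed on arbitrary representatives *)

Section Invariance.
Variable k : fieldType.

(** The poset representing [rtree_of P] is merely isomorphic to [P]. Conjugating attaching maps by
    the isomorphisms is a bijection that preserves the resulting trees. *)
Lemma glT_rtree_of (P Q : treeposet) :
  glT k (rtree_of P) (rtree_of Q) =
    \sum_(f : {ffun child P -> Q})
       << rtree_of (attach (fun c : child P => downset (val c)) f) >>.
Proof.
have [p pI] := isomorphic_sym (rep_rtree_of P).
have [q qI] := isomorphic_sym (rep_rtree_of Q).
have [h [h' hK h'K] hE] := iso_child_bij pI; have [[q' qK q'K] _] := qI.
pose A (f : {ffun child P -> Q}) : {ffun child (rtree_of P) -> rtree_of Q} :=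
  [ffun c => q (f (h' c))].
have Ab : bijective A.
  exists (fun f : {ffun child (rtree_of P) -> rtree_of Q} => [ffun c => q' (f (h c))]) => f; apply/ffunP => c.
    by rewrite !ffunE hK qK.
  by rewrite !ffunE h'K q'K.
rewrite /glT (reindex A) /=; last exact: (onW_bij _ Ab).
apply: eq_bigr => f _; congr << _ >>; apply/esym/rtree_of_iso.
apply: (attach_iso (h := h) (psi := q)) => //; first by exists h'.
  by move=> c; rewrite hE; apply: downset_iso.
by move=> c; rewrite ffunE hK.
Qed.

Definition Bplus_children (P : treeposet) (I : {set child P}) : treeposet :=
  Bplus (fun c : {c : child P | c \in I} => downset (val (val c))).

Lemma coprodT_rtree_of (P : treeposet) :
  coprodT k (rtree_of P) =
    \sum_(I : {set child P})
       << (rtree_of (Bplus_children I), rtree_of (Bplus_children (~: I))) >>.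
Proof.
have [p pI] := isomorphic_sym (rep_rtree_of P).
have [h hb hE] := iso_child_bij pI; have [h' hK h'K] := hb.
have hinj := can_inj hK.
have key (I : {set child P}) :
    BplusOf (h @: I) = rtree_of (Bplus_children I).
  have hI (c : {c : child P | c \in I}) : h (val c) \in h @: I.
    by rewrite mem_imset ?(valP c).
  have kI (c : {c : child (rtree_of P) | c \in h @: I}) : h' (val c) \in I.
    by rewrite -(mem_imset _ _ hinj) h'K (valP c).
  apply/esym/rtree_of_iso.
  apply: (attach_iso (h := fun c => exist _ (h (val c)) (hI c)) (psi := id)) => //.
  - by exists (fun c => exist _ (h' (val c)) (kI c)) => x; apply: val_inj; rewrite /= ?hK ?h'K.
  - by split=> //; exists id.
  - by move=> c /=; rewrite hE; apply: downset_iso.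
rewrite /coprodT (reindex (fun I : {set child P} => h @: I)) /=.
  apply: eq_bigr => I _; rewrite key; congr << (_, _) >>; rewrite -key; congr BplusOf.
  apply/setP => c; rewrite -(h'K c) !inE !mem_imset ?inE //.
apply: onW_bij; exists (fun I : {set child (rtree_of P)} => h' @: I) => I; apply/setP => c.
  by rewrite -imset_comp (eq_imset (g := id)) ?imset_id // => x; rewrite /= hK.
by rewrite -imset_comp (eq_imset (g := id)) ?imset_id // => x; rewrite /= h'K.
Qed.

End Invariance.

(** * Forest orders on a fixed vertex set *)

Section Forests.
Variable T : finType.

Definition is_forest (e : rel T) : Prop :=
  [/\ reflexive e, antisymmetric e, transitive e &
      forall v x y, e v x -> e v y -> e x y || e y x].

(** Orders are stored as Boolean finite functions, so that forests form a finite type over which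
    sums can range and equality is extensional. *)
Definition forest : Type :=
  {r : {ffun T * T -> bool} | `[< is_forest (fun x y => r (x, y)) >]}.

HB.instance Definition _ := Finite.on forest.

Definition fle (r : forest) : rel T := fun x y => val r (x, y).

Lemma fleP r : is_forest (fle r).
Proof. exact: asboolW (valP r). Qed.

Lemma flexx r : reflexive (fle r). Proof. by case: (fleP r). Qed.

Lemma fle_trans r : transitive (fle r). Proof. by case: (fleP r). Qed.

Lemma fle_anti r : antisymmetric (fle r). Proof. by case: (fleP r). Qed.

Lemma fle_chain r v x y : fle r v x -> fle r v y -> fle r x y || fle r y x.
Proof. by case: (fleP r) => _ _ _; apply. Qed.

Lemma fle_ext r s : fle r =2 fle s -> r = s.
Proof.
by move=> rs; apply/val_inj/ffunP => -[x y]; apply: rs.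
Qed.

Section MkForest.
Variables (e : rel T) (eP : is_forest e).

Let mkfun : {ffun T * T -> bool} := [ffun p => e p.1 p.2].

Lemma mkforest_subproof : is_forest (fun x y => mkfun (x, y)).
Proof.
case: eP => r a t c; split.
- by move=> x; rewrite ffunE.
- by move=> x y; rewrite !ffunE; apply: a.
- by move=> y x z; rewrite !ffunE; apply: t.
- by move=> v x y; rewrite !ffunE; apply: c.
Qed.

Definition mkforest : forest := exist _ mkfun (asboolT mkforest_subproof).

Lemma mkforestE : fle mkforest =2 e.
Proof. by move=> x y; rewrite /fle /= ffunE. Qed.

End MkForest.

Section Tree.
Variable r : forest.

Definition ftree_le : rel (option T) := fun x y =>
  match x, y with
  | _, None => true
  | None, Some _ => false
  | Some x, Some y => fle r x y
  end.

Lemma ftree_leP : is_rooted_tree ftree_le.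
Proof.
apply: is_rooted_tree_greatest.
- by move=> [x|] //=; apply: flexx.
- by move=> [x|] [y|] //= /fle_anti ->.
- by move=> [y|] [x|] [z|] //=; apply: fle_trans.
- by exists None => -[].
- by move=> [v|] [x|] [y|] //=; apply: fle_chain.
Qed.

Definition ftree : treeposet := TreePoset ftree_leP.

Lemma ftree_root : troot = None :> ftree.
Proof. by have := tle_root (None : ftree); case: troot. Qed.

Lemma ftree_childP (v : T) :
  reflect (forall w, fle r v w -> w = v) ((Some v : ftree) \in children ftree).
Proof.
apply: (iffP (childP _)); rewrite ftree_root.
  by move=> [_ h] w vw; have [[]|] := h (Some w) vw.
by move=> h; split=> // -[w /h ->|]; [left|right].
Qed.

End Tree.
End Forests.

(** * Restriction and relabelling of forests along injections *)

Section Pull.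
Variables (D T : finType) (h : D -> T) (hinj : injective h).

Lemma pull_subproof (r : forest T) : is_forest (fun x y => fle r (h x) (h y)).
Proof.
split.
- by move=> x; apply: flexx.
- by move=> x y /fle_anti/hinj.
- by move=> y x z; apply: fle_trans.
- by move=> v x y; apply: fle_chain.
Qed.

Definition pull (r : forest T) : forest D := mkforest (pull_subproof r).

Lemma pullE r x y : fle (pull r) x y = fle r (h x) (h y).
Proof. exact: mkforestE. Qed.

End Pull.

Lemma pull_bij (D T : finType) (h : D -> T) (hinj : injective h) :
  bijective h -> bijective (pull hinj).
Proof.
move=> [g hK gK]; have ginj := can_inj gK.
by exists (pull ginj) => r; apply: fle_ext => x y; rewrite !pullE ?hK ?gK.
Qed.

Lemma pull_iso (D T : finType) (h : D -> T) (hinj : injective h) (r : forest T) :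
  bijective h -> isomorphic (ftree (pull hinj r)) (ftree r).
Proof.
move=> [g hK gK].
apply: (@surj_mono_isomorphic (ftree (pull hinj r)) (ftree r) (omap h)).
  by move=> [x|] [y|] //=; rewrite pullE.
by move=> [y|]; [exists (Some (g y)); rewrite /= gK | exists None].
Qed.

(** * Counting the forest orders that represent a given tree *)

Section Labellings.
Variables (T : finType) (P : treeposet).
Hypothesis cardP : #|P| = #|T|.+1.

Definition nonroot : finType := {x : P | x != troot}.

Lemma card_nonroot : #|nonroot| = #|T|.
Proof.
rewrite card_sig; have := cardC (pred1 (troot : P)); rewrite card1 cardP => -[<-].
by apply: eq_card.
Qed.

Section Pullback.
Variable f : {ffun T -> nonroot}.
Hypothesis finj : injective f.

Lemma pullback_subproof : is_forest (fun x y => tle (val (f x)) (val (f y))).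
Proof.
split.
- by move=> x; apply: tlexx.
- by move=> x y /tle_anti/val_inj/finj.
- by move=> y x z; apply: tle_trans.
- by move=> v x y; apply: tle_chain.
Qed.

Definition ext_label (x : option T) : P := if x is Some y then val (f y) else troot.

Lemma ext_label_inj : injective ext_label.
Proof.
move=> [x|] [y|] //= e.
- by congr Some; apply/finj/val_inj.
- by have := valP (f x); rewrite /= e eqxx.
- by have := valP (f y); rewrite /= -e eqxx.
Qed.

End Pullback.

Definition labels (r : forest T) (f : {ffun T -> nonroot}) : bool :=
  [forall x, forall y, tle (val (f x)) (val (f y)) == fle r x y].

Lemma labelsP r (f : {ffun T -> nonroot}) :
  reflect (forall x y, tle (val (f x)) (val (f y)) = fle r x y) (labels r f).
Proof.
apply: (iffP forallP) => [h x y|h x]; first by have /forallP/(_ y)/eqP := h x.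
by apply/forallP => y; rewrite h.
Qed.

Lemma labels_inj r (f : {ffun T -> nonroot}) : labels r f -> injective f.
Proof.
by move=> /labelsP h x y e; apply: (@fle_anti _ r); rewrite -!h e !tlexx.
Qed.

Lemma labels_iso r (f : {ffun T -> nonroot}) : labels r f -> @is_iso (ftree r) P (ext_label f).
Proof.
move=> rf; have finj := labels_inj rf.
split; first by apply: inj_card_bij (ext_label_inj finj) _; rewrite card_option cardP.
move: rf => /labelsP h [x|] [y|] /=; rewrite ?tle_root //.
- exact: h.
- apply/negbTE; apply/negP => le; have := valP (f y); rewrite /=.
  by move/eqP; apply; apply: tle_anti; rewrite le tle_root.
Qed.

(** A labelling inducing [r] amounts to an isomorphism from [ftree r] to [P]. Once one isomorphism
    [phi] is fixed, all of them are its composites with the automorphisms of [P]. *)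
Lemma card_labels r :
  #|[set f | labels r f]| = if `[< isomorphic (ftree r) P >] then #|Symm P| else 0%N.
Proof.
case: asboolP => [[phi phiI]|nI]; last first.
  apply/eqP; rewrite cards_eq0; apply/eqP/setP => f; rewrite !inE.
  by apply/negP => rf; apply: nI; exists (ext_label f); apply: labels_iso.
have [[phi' phiK phi'K] phim] := phiI.
have phir : phi None = troot by rewrite -(iso_root phiI) ftree_root.
have nr (s : {perm P}) : s \in Symm P -> forall x, s (phi (Some x)) != troot.
  move=> /SymmP sm x.
  have sI : is_iso s by split=> //; exists (s^-1)%g; [apply: permK|apply: permKV].
  by rewrite -[troot](iso_root sI) -phir (inj_eq perm_inj) (inj_eq (can_inj phiK)).
have mk (s : {perm P}) : s \in Symm P ->
    {f : {ffun T -> nonroot} | forall x, val (f x) = s (phi (Some x))}.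
  move=> sS; exists [ffun x => (exist _ (s (phi (Some x))) (nr s sS x) : nonroot)] => x.
  by rewrite ffunE.
pose G (s : {s : {perm P} | s \in Symm P}) := sval (mk _ (valP s)).
have GE s x : val (G s x) = val s (phi (Some x)) := svalP (mk _ (valP s)) x.
rewrite -[RHS]card_sig -cardsT.
have Ginj : injective G.
  move=> s u e; apply/val_inj/permP => p; rewrite -(phi'K p).
  case: (phi' p) => [x|]; first by rewrite -!GE e.
  (* Every automorphism fixes the root, so [s] and [u] agree there too. *)
  have rt (v : {s : {perm P} | s \in Symm P}) : val v (phi None) = troot.
    rewrite phir; apply: iso_root; split; last by apply/SymmP/(valP v).
    by exists ((val v)^-1)%g; [apply: permK|apply: permKV].
  by rewrite !rt.
rewrite -(card_imset _ Ginj); apply: eq_card => f; rewrite !inE.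
apply/idP/imsetP => [rf|[s _ ->]]; last first.
  apply/labelsP => x y; rewrite !GE.
  by have /SymmP -> := valP s; rewrite phim.
have fI := labels_iso rf; have fb := fI.1.
have sinj : injective (ext_label f \o phi').
  by apply: inj_comp (bij_inj fb) (can_inj phi'K).
have sS : perm sinj \in Symm P.
  apply/SymmP => x y; rewrite !permE /= fI.2.
  by rewrite -[in RHS](phi'K x) -[in RHS](phi'K y) phim.
exists (exist (fun s => s \in Symm P) _ sS) => //; apply/ffunP => x; apply: val_inj.
by rewrite GE /= permE /= phiK.
Qed.

(** The injections from [T] to the non-root vertices are counted by the order that they induce on
    [T]: an order is induced [#|Symm P|] times if its tree is isomorphic to [P], and never
    otherwise. *)
Lemma card_forest_iso :
  (#|[set r : forest T | `[< isomorphic (ftree r) P >]]| * #|Symm P| = (#|T|)`!)%N.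
Proof.
have <- : #|[set f : {ffun T -> nonroot} | injectiveb f]| = (#|T|)`!.
  by rewrite card_inj_ffuns card_nonroot ffactnn.
have -> : #|[set f : {ffun T -> nonroot} | injectiveb f]| =
    \sum_(r : forest T) #|[set f | labels r f]|.
  (* The induced order requires a proof of injectivity, so the classifying map takes values in an
     option type, with [None] off the injections. *)
  rewrite -sum1_card (partition_big (fun f : {ffun T -> nonroot} =>
    if pselect (injective f) is left i then Some (mkforest (pullback_subproof i))
    else None) (fun r => r != None)) /=; last first.
    by move=> f; rewrite inE => /injectiveP fi; case: pselect.
  rewrite (reindex_omap Some id) /=; last by case.
  apply: eq_big => [r|r _]; rewrite ?eqxx // -sum1_card; apply: eq_bigl => f.
  rewrite !inE; apply/andP/labelsP => [[/injectiveP fi]|rf].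
    by case: pselect => // i /eqP[<-] x y; rewrite mkforestE.
  have fi : injective f by apply: (@labels_inj r); apply/labelsP.
  split; first exact/injectiveP.
  case: pselect => // i; apply/eqP; congr Some; apply: fle_ext => x y.
  by rewrite mkforestE rf.
rewrite -sum_nat_const (eq_bigr _ (fun r _ => card_labels r)).
by rewrite -big_mkcond /=; apply: eq_bigl => r; rewrite inE.
Qed.

End Labellings.

(** * Sums weighted by inverse symmetry numbers as sums over forests *)

Section SumTrees.
Variables (k : fieldType) (hk : [pchar k] =i pred0).

Lemma natr_fact_neq0 n : (n`!)%:R != 0 :> k.
Proof. by rewrite (iffLR (pcharf0P k) hk) -lt0n fact_gt0. Qed.

Lemma sum_trees_Symm (V : lmodType k) (F : rtree -> V) (T : finType) :
  \sum_(t <- trees #|T|) (#|Symm (rep t)|%:R)^-1 *: F t =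
  ((#|T|)`!%:R)^-1 *: \sum_(r : forest T) F (rtree_of (ftree r)).
Proof.
have -> : \sum_(r : forest T) F (rtree_of (ftree r)) =
    \sum_(r : forest T) \sum_(t <- trees #|T| | t == rtree_of (ftree r)) F t.
  apply: eq_bigr => r _; rewrite -big_filter (filter_pred1_uniq (fset_uniq _)) ?big_seq1 //.
  by rewrite in_trees (isomorphic_card (rep_rtree_of _)) card_option.
rewrite (exchange_big_dep predT) //= scaler_sumr big_seq [RHS]big_seq.
apply: eq_bigr => t; rewrite in_trees => /eqP ct.
rewrite sumr_const -scaler_nat scalerA; congr (_ *: _).
have := card_forest_iso ct.
set N := #|[set r | _]| => NE.
have -> : #|[pred r : forest T | t == rtree_of (ftree r)]| = N.
  apply: eq_card => r; rewrite !inE; apply/eqP/asboolP => [->|h].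
    exact/isomorphic_sym/rep_rtree_of.
  by rewrite -[LHS]rtree_ofK; apply/rtree_of_iso/isomorphic_sym.
(* Both [N] and the order of the symmetry group are nonzero in [k], because their product is the
   factorial of [#|T|]. *)
have := natr_fact_neq0 #|T|; rewrite -NE natrM mulf_eq0 negb_or => /andP[N0 S0].
by rewrite invfM mulrAC mulVf // mul1r.
Qed.

Lemma linext_kappa (V : lmodType k) (F : rtree -> V) (T : finType) :
  linext F (kappa k #|T|) =
  ((#|T|)`!%:R)^-1 *: \sum_(r : forest T) F (rtree_of (ftree r)).
Proof.
rewrite -(sum_trees_Symm F) /kappa linear_sum; apply: eq_bigr => t _.
by rewrite linearZ /= linextU.
Qed.

Lemma kappaE (T : finType) :
  kappa k #|T| =
  ((#|T|)`!%:R)^-1 *: \sum_(r : forest T) << rtree_of (ftree r) >>.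
Proof. by rewrite -(sum_trees_Symm (fun t => << t >>)). Qed.

End SumTrees.

(** * The corolla and its automorphisms *)

Section Discrete.
Variable T : finType.

Lemma discrete_subproof : is_forest (@eq_op T).
Proof.
split.
- by move=> x; apply: eqxx.
- by move=> x y /andP[/eqP].
- by move=> y x z /eqP ->.
- by move=> v x y /eqP <- ->.
Qed.

Definition discrete : forest T := mkforest discrete_subproof.

Lemma discreteE x y : fle discrete x y = (x == y).
Proof. exact: mkforestE. Qed.

Lemma rtree_of_discrete : rtree_of (ftree discrete) = tpart (ones #|T|).
Proof.
have sz : size (ones #|T|) = #|T| by rewrite size_nseq.
apply/esym/rtree_of_iso; set B := Bplus _.
pose F (x : B) : ftree discrete :=
  if x is inr p then Some (enum_val (cast_ord sz (tag p))) else None.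
apply: (@surj_mono_isomorphic B _ F).
  move=> [[]|[i u]] [[]|[j w]] //=.
  rewrite discreteE (inj_eq (@enum_val_inj _ _)) (inj_eq (@cast_ord_inj _ _ _)).
  case: eqVneq => //= ij; case: j / ij w => w; rewrite tagged_asE; symmetry.
  (* Every part is 1, so the branch has a single vertex and [u] must be 0. *)
  have l1 : (nth 0%N (ones #|T|) i).-1 = 0%N.
    by rewrite nth_nseq -[X in (_ < X)%N]sz ltn_ord.
  by have := ltn_ord u; rewrite [X in (_ < X.+1)%N]l1 ltnS leqn0 /= => /eqP ->.
move=> [y|]; last by exists (inl tt).
pose E (i : 'I_(size (ones #|T|))) : Type := ell (nth 0%N (ones #|T|) i).
pose i := cast_ord (esym sz) (enum_rank y).
exists (inr (Tagged E (ord0 : E i))).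
by rewrite /F /= /i cast_ordKV enum_rankK.
Qed.

Lemma isomorphic_discrete (r : forest T) :
  isomorphic (ftree r) (ftree discrete) -> r = discrete.
Proof.
move=> [f fI]; have [[g fK gK] fm] := fI; apply: fle_ext => x y; rewrite discreteE.
have -> : fle r x y = tle (f (Some x)) (f (Some y)) by rewrite fm.
have fN : f None = None.
  by have := iso_root fI; rewrite !ftree_root.
have fS z : exists w, f (Some z) = Some w.
  case e : (f (Some z)) => [w|]; first by exists w.
  by have /(can_inj fK) : f (Some z) = f None by rewrite e fN.
have [[a xa] [b yb]] := (fS x, fS y).
rewrite xa yb [LHS]discreteE -(inj_eq (@Some_inj _)) -xa -yb (inj_eq (can_inj fK)).
by rewrite (inj_eq (@Some_inj _)).
Qed.

End Discrete.

(** By [isomorphic_discrete] exactly one forest order on ['I_n] gives the corolla, so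
    [card_forest_iso] yields the whole factorial. *)
Lemma card_Symm_tpart_ones n : #|Symm (tpart (ones n))| = n`!.
Proof.
set P := rep _; have PI : isomorphic P (ftree (discrete 'I_n)).
  by apply: isomorphic_trans (rep_rtree_of _); rewrite rtree_of_discrete card_ord; apply: isomorphic_refl.
have cP : #|P| = #|'I_n|.+1 by rewrite (isomorphic_card PI) card_option.
have := card_forest_iso cP; rewrite card_ord => <-.
suff -> : [set r : forest 'I_n | `[< isomorphic (ftree r) P >]] = [set discrete 'I_n].
  by rewrite cards1 mul1n.
apply/setP => r; rewrite !inE; apply/asboolP/eqP => [rP|->].
  by apply/isomorphic_discrete/(isomorphic_trans rP).
exact: isomorphic_sym.
Qed.

(** * Attaching branches to a corolla as gluing of forests *)

Lemma tle_downsets (P Q : treeposet) (I : finType) (c : I -> P) (f : I -> Q)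
    (p q : {i : I & downset (c i)}) :
  injective c -> (forall i, c i \in children P) ->
  @tle (attach (fun i => downset (c i)) f) (inr p) (inr q) =
  tle (val (tagged p)) (val (tagged q)).
Proof.
move=> cinj cch; case: p q => [i u] [j w] /=.
case: (eqVneq i j) => [ij|ij] /=.
  by case: j / ij w => w; rewrite tagged_asE.
(* No vertex lies below two distinct children, so vertices of different branches are incomparable in
   [P] as well. *)
symmetry; apply/negbTE/negP => uw; move/eqP: ij; apply; apply: cinj.
by apply: (child_uniq (cch i) (cch j) (valP u)); apply: tle_trans uw (valP w).
Qed.

Section Glue.
Variables (V W : finType) (q : forest V).
Implicit Types (f : {ffun child (ftree q) -> ftree (discrete W)}).

(** The order on the non-root vertices after attaching: [V] carries the branches, [W] the leaves of
    the corolla. A branch with [f c = None] is attached to the root, hence lies below no leaf. *)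
Definition glue_le f : rel (V + W)%type := fun x y =>
  match x, y with
  | inl x, inl y => fle q x y
  | inl x, inr j => [exists c, @tle (ftree q) (Some x) (val c) && (f c == Some j)]
  | inr _, inl _ => false
  | inr i, inr j => i == j
  end.

Lemma forest_child (x : V) : exists c : child (ftree q), @tle (ftree q) (Some x) (val c).
Proof.
have [|c cch xc] := @ex_child (ftree q) (Some x); first by rewrite ftree_root.
by exists (exist _ c cch).
Qed.

Lemma glue_le_child f x j (c : child (ftree q)) :
  @tle (ftree q) (Some x) (val c) -> glue_le f (inl x) (inr j) = (f c == Some j).
Proof.
move=> xc; apply/existsP/idP => [[d /andP[xd]]|fc]; last by exists c; rewrite xc.
by rewrite (_ : d = c) //; apply/val_inj/(child_uniq (valP d) (valP c) xd).
Qed.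

Lemma glue_subproof f : is_forest (glue_le f).
Proof.
split.
- by move=> [x|j] /=; [apply: flexx|apply: eqxx].
- move=> [x|i] [y|j] //=; first by move/fle_anti=> ->.
    by rewrite andbF.
  by move=> /andP[/eqP->].
- move=> [y|j] [x|i] [z|l] //.
  + exact: fle_trans.
  (* A vertex and everything below it lie under the same child, and that child decides which leaf is
     above. *)
  + move=> /= xy; have [c yc] := forest_child y.
    rewrite -!/(glue_le f (inl _) (inr _)) !(glue_le_child f l (c := c)) //.
    exact: (@tle_trans (ftree q) (Some y) (Some x) (val c) xy yc).
  + by move=> xj /eqP <-.
  + by move=> /eqP->.
- move=> [v|i] [x|j] [y|l] //.
  + exact: fle_chain.
  + have [c xc] := forest_child x => vx.
    rewrite (glue_le_child f l xc) (glue_le_child f l (c := c)) ?orbF => [->//|].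
    exact: (@tle_trans (ftree q) (Some x) (Some v) (val c) vx xc).
  + have [c yc] := forest_child y => + vy.
    rewrite (glue_le_child f j yc) (glue_le_child f j (c := c)) => [->|]; first exact: orbT.
    exact: (@tle_trans (ftree q) (Some y) (Some v) (val c) vy yc).
  + have [c vc] := forest_child v; rewrite !(glue_le_child f _ vc).
    by move=> /eqP -> /eqP[->]; rewrite /= eqxx.
  + by move=> /eqP-> /eqP->; rewrite /= eqxx.
Qed.

Definition glue f : forest (V + W)%type := mkforest (glue_subproof f).

Lemma glueE f x y : fle (glue f) x y = glue_le f x y.
Proof. exact: mkforestE. Qed.

Lemma attach_glue f :
  isomorphic (attach (fun c : child (ftree q) => downset (val c)) f) (ftree (glue f)).
Proof.
set A := attach _ f.
pose F (x : A) : ftree (glue f) :=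
  match x with
  | inl a => omap inr (a : option W)
  | inr p => omap inl (val (tagged p) : option V)
  end.
have pS (p : {c : child (ftree q) & downset (val c)}) :
    exists x, val (tagged p) = Some x.
  case e : (val (tagged p)) => [x|]; first by exists x.
  by have := child_nroot (valP (tag p)) (valP (tagged p)); rewrite e ftree_root.
apply: (@surj_mono_isomorphic A _ F).
  move=> [a|p] [b|r]; last first.
  - rewrite tle_downsets; [|exact: val_inj|by move=> c; apply: valP].
    have [[x px] [y ry]] := (pS p, pS r); rewrite /F px ry.
    by rewrite [LHS]glueE.
  - have [x px] := pS p; rewrite /F px.
    case: b => [j|]; last first.
      by change (true = ftree_le (discrete W) (f (tag p)) None); case: (f (tag p)).
    have pc : @tle (ftree q) (Some x) (val (tag p)) by rewrite -px; apply: (valP (tagged p)).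
    rewrite [LHS]glueE (glue_le_child f j pc).
    change ((f (tag p) == Some j) = ftree_le (discrete W) (f (tag p)) (Some j)).
    by case: (f (tag p)) => [i|] //=; rewrite discreteE.
  - have [y ry] := pS r; rewrite /F ry.
    by case: a => [i|] //; rewrite [LHS]glueE.
  - by case: a b => [i|] [j|] //=; rewrite glueE discreteE.
move=> [[x|j]|]; last 2 first.
- by exists (inl (Some j)).
- by exists (inl None).
have [c xc] := forest_child x.
pose E (c : child (ftree q)) : Type := downset (val c).
by exists (inr (Tagged E (exist _ (Some x) xc : E c))).
Qed.

(** The vertices in [W] are children of the root of [ftree r]. Among the orders restricting to [q]
    on [V], this characterizes the image of [glue]. *)
Definition right_max (r : forest (V + W)%type) : bool :=
  [forall j, forall x, fle r (inr j) x ==> (x == inr j)].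

Lemma right_maxP r :
  reflect (forall j x, fle r (inr j) x -> x = inr j) (right_max r).
Proof.
apply: (iffP forallP) => [h j x jx|h j].
  by have /forallP/(_ x) := h j; rewrite jx => /eqP.
by apply/forallP => x; apply/implyP => /h->.
Qed.

(** The inverse of [glue]: a child returns to the leaf above it, or to the root of the corolla if
    there is none. *)
Definition unglue (r : forest (V + W)%type) : {ffun child (ftree q) -> ftree (discrete W)} :=
  [ffun c => if (val c : option V) is Some x then [pick j | fle r (inl x) (inr j)] else None].

Lemma child_Some (c : child (ftree q)) : exists x, val c = Some x.
Proof.
case e : (val c) => [x|]; first by exists x.
by have /childP[] := valP c; rewrite e ftree_root.
Qed.

Lemma glueK f : unglue (glue f) = f.
Proof.
apply/ffunP => c; rewrite ffunE; have [x cx] := child_Some c; rewrite cx.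
have xc : @tle (ftree q) (Some x) (val c) by rewrite cx tlexx.
case: pickP => [j|h]; first by rewrite glueE (glue_le_child f j xc) => /eqP->.
case e : (f c) => [j|//]; have := h j.
by rewrite glueE (glue_le_child f j xc) e eqxx.
Qed.

Lemma right_max_glue f : right_max (glue f).
Proof. by apply/right_maxP => j [x|i]; rewrite glueE //= => /eqP->. Qed.

Lemma pull_inl_glue f : pull inl_inj (glue f) = q.
Proof. by apply: fle_ext => x y; rewrite pullE glueE. Qed.

(** The hypotheses fix all relations except those from [V] to [W], and these are constant along each
    branch. *)
Lemma unglueK r : right_max r -> pull inl_inj r = q -> glue (unglue r) = r.
Proof.
move=> /right_maxP rmax rq; apply: fle_ext => -[x|i] [y|j]; rewrite glueE.
- by rewrite /= -rq pullE.
- have [c xc] := forest_child x; rewrite (glue_le_child _ _ xc) ffunE.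
  have [y cy] := child_Some c; rewrite cy; rewrite cy in xc.
  have {}xc : fle r (inl x) (inl y) by move: xc; rewrite -rq -(pullE inl_inj).
  (* If [x] lies below both [y] and [j], these two are comparable, and the maximality of [j] puts
     [y] below [j]. *)
  have yj : fle r (inl x) (inr j) = fle r (inl y) (inr j).
    apply/idP/idP => [xj|]; last exact: fle_trans xc.
    by case/orP: (fle_chain xc xj) => // /rmax.
  rewrite yj; case: pickP => [l yl|->//]; apply/eqP/idP => [[<-]//|yj'].
  (* Two leaves above [y] are comparable and both maximal, hence equal. *)
  by case/orP: (fle_chain yl yj') => /rmax[->].
- by symmetry; apply/negbTE/negP => /rmax.
- apply/eqP/idP => [->|/rmax[->//]]; exact: flexx.
Qed.

End Glue.

Lemma sum_glT (k : fieldType) (V W : finType) :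
  \sum_(q : forest V) glT k (rtree_of (ftree q)) (rtree_of (ftree (discrete W))) =
  \sum_(r : forest (V + W)%type | right_max r) << rtree_of (ftree r) >>.
Proof.
rewrite [RHS](partition_big (pull inl_inj) predT) //=; apply: eq_bigr => q _.
rewrite glT_rtree_of [RHS](reindex_onto (@glue V W q) (@unglue V W q)) /=; last first.
  by move=> r /andP[rm /eqP rq]; apply: unglueK.
apply: eq_big => f; first by rewrite right_max_glue pull_inl_glue glueK !eqxx.
by move=> _; congr << _ >>; apply/rtree_of_iso/attach_glue.
Qed.

(** * Disjoint sums of forests *)

Section DirectSum.
Variables V W : finType.

Definition dsum_le (r : forest V) (s : forest W) : rel (V + W)%type := fun x y =>
  match x, y with
  | inl x, inl y => fle r x y
  | inr x, inr y => fle s x y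
  | _, _ => false
  end.

Lemma dsum_subproof r s : is_forest (dsum_le r s).
Proof.
split.
- by move=> [x|x]; apply: flexx.
- by move=> [x|x] [y|y] //= /fle_anti ->.
- by move=> [y|y] [x|x] [z|z] //=; apply: fle_trans.
- by move=> [v|v] [x|x] [y|y] //=; apply: fle_chain.
Qed.

Definition dsum r s : forest (V + W)%type := mkforest (dsum_subproof r s).

Definition is_dsum (r : forest (V + W)%type) : bool :=
  [forall x, forall y, ~~ fle r (inl x) (inr y) && ~~ fle r (inr y) (inl x)].

Lemma sum_dsum (M : nmodType) (H : forest V -> forest W -> M) :
  \sum_(r | is_dsum r) H (pull inl_inj r) (pull inr_inj r) =
  \sum_r \sum_s H r s.
Proof.
rewrite pair_big /=.
pose D (p : forest V * forest W) := dsum p.1 p.2.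
pose U r : forest V * forest W := (pull inl_inj r, pull inr_inj r).
have DK p : U (D p) = p.
  by case: p => r s; congr (_, _); apply: fle_ext => x y; rewrite pullE mkforestE.
rewrite (reindex_onto D U) /=; last first.
  move=> r /forallP rd; apply: fle_ext => x y; rewrite mkforestE.
  case: x y => [x|x] [y|y] /=; rewrite ?pullE //.
    by have /forallP/(_ y)/andP[/negbTE->] := rd x.
  by have /forallP/(_ x)/andP[_ /negbTE->] := rd y.
apply: eq_big => p; last first.
  by move=> _; have := DK p; rewrite /U => {3 4}<-.
rewrite DK eqxx andbT; apply/forallP => x; apply/forallP => y.
by rewrite !mkforestE.
Qed.

End DirectSum.

(** * Transfer to a subset and its complement *)

Section Split.
Variables (T : finType) (U : {set T}).

Definition split_fun (x : {x | x \in U} + {x | x \in ~: U}) : T :=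
  match x with inl a => val a | inr b => val b end.

Lemma split_fun_bij : bijective split_fun.
Proof.
have inj : injective split_fun.
  move=> [[a aU]|[a aU]] [[b bU]|[b bU]] /= ab; subst b.
  - by congr inl; apply: val_inj.
  - by exfalso; rewrite inE aU in bU.
  - by exfalso; rewrite inE bU in aU.
  - by congr inr; apply: val_inj.
by apply: inj_card_bij inj _; rewrite card_sum !card_sig cardsC.
Qed.

Definition pull_to (A : {set T}) (r : forest T) : forest {x | x \in A} :=
  pull (@val_inj _ _ {x | x \in A}) r.

(** These [U] are the vertex sets of unions of branches. *)
Definition closed_in (r : forest T) : bool :=
  [forall x, forall y, fle r x y ==> ((x \in U) == (y \in U))].

Lemma closed_inP r :
  reflect (forall x y, fle r x y -> (x \in U) = (y \in U)) (closed_in r).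
Proof.
apply: (iffP forallP) => [h x y xy|h x].
  by have /forallP/(_ y) := h x; rewrite xy => /eqP.
by apply/forallP => y; apply/implyP => /h->.
Qed.

Let split_inj := bij_inj split_fun_bij.

(** This is [sum_dsum] carried along [split_fun]: closedness of [U] says that no vertex of [U] is
    comparable with one outside. *)
Lemma sum_closed_in (M : nmodType)
    (H : forest {x | x \in U} -> forest {x | x \in ~: U} -> M) :
  \sum_(r | closed_in r) H (pull_to U r) (pull_to (~: U) r) = \sum_r \sum_s H r s.
Proof.
rewrite -sum_dsum (reindex (pull split_inj)) /=; last first.
  exact/onW_bij/pull_bij/split_fun_bij.
apply: eq_big => [r|r _]; last first.
  by congr H; apply: fle_ext => x y; rewrite !pullE.
apply/closed_inP/forallP => [h x|h x y xy].
  apply/forallP => y; rewrite !pullE /=; apply/andP.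
  by split; apply/negP => /h; have := valP y; rewrite inE => /negbTE->; rewrite (valP x).
have cross a b : a \in U -> b \notin U -> ~~ fle r a b && ~~ fle r b a.
  rewrite -in_setC => aU bU.
  by have /forallP/(_ (exist _ b bU)) := h (exist _ a aU); rewrite !pullE.
case: (boolP (x \in U)) => xU; case: (boolP (y \in U)) => yU //.
  by have := cross _ _ xU yU; rewrite xy.
by have := cross _ _ yU xU; rewrite xy andbF.
Qed.

(** The children of the root of [ftree r]; their number is the d(r) of the outline. *)
Definition maxs (r : forest T) : {set T} :=
  [set x | [forall y, fle r x y ==> (y == x)]].

Lemma maxsP r x : reflect (forall y, fle r x y -> y = x) (x \in maxs r).
Proof.
rewrite inE; apply: (iffP forallP) => [h y xy|h y].
  by have := h y; rewrite xy => /eqP.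
by apply/implyP => /h->.
Qed.

(** This is [sum_glT] carried along [split_fun], the leaves of the corolla being the vertices
    outside [U]. *)
Lemma sum_glT_ones (k : fieldType) :
  \sum_(q : forest {x | x \in U})
     glT k (rtree_of (ftree q)) (tpart (ones #|~: U|)) =
  \sum_(r : forest T | ~: U \subset maxs r) << rtree_of (ftree r) >>.
Proof.
have -> : #|~: U| = #|{: {x | x \in ~: U}}| by rewrite card_sig.
rewrite -rtree_of_discrete sum_glT (reindex (pull split_inj)) /=; last first.
  exact/onW_bij/pull_bij/split_fun_bij.
apply: eq_big => [r|r _]; last first.
  by congr << _ >>; apply/rtree_of_iso/pull_iso/split_fun_bij.
apply/right_maxP/fintype.subsetP => [h x xU|h j x].
  apply/maxsP => y xy; have [g gK Kg] := split_fun_bij.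
  have := h (exist _ x xU) (g y); rewrite pullE Kg => /(_ xy) e.
  by rewrite -[y]Kg e.
rewrite pullE => jx; apply: split_inj; have /maxsP := h _ (valP j).
by apply.
Qed.

End Split.

(** * Sets of branches as closed vertex sets *)

Section Branches.
Variables (T : finType) (r : forest T).
Implicit Types (I : {set child (ftree r)}) (U : {set T}).

(** With [tops] as inverse, this identifies the sets of children of the root with the sets closed in
    [r], complements going to complements. *)
Definition below I : {set T} :=
  [set x | [exists c in I, @tle (ftree r) (Some x) (val c)]].

Definition tops U : {set child (ftree r)} :=
  [set c | [exists x in U, val c == Some x]].

Lemma mem_below I x (c : child (ftree r)) :
  @tle (ftree r) (Some x) (val c) -> (x \in below I) = (c \in I).
Proof.
move=> xc; rewrite inE; apply/exists_inP/idP => [[d dI xd]|cI]; last by exists c.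
by rewrite (_ : c = d) //; apply/val_inj/(child_uniq (valP c) (valP d) xc).
Qed.

Lemma below_closed I : closed_in (below I) r.
Proof.
apply/closed_inP => x y xy; have [c yc] := forest_child r y.
rewrite (mem_below I yc) (mem_below I (c := c)) //.
exact: (@tle_trans (ftree r) (Some y) (Some x) (val c) xy yc).
Qed.

Lemma belowC I : below (~: I) = ~: below I.
Proof.
apply/setP => x; have [c xc] := forest_child r x.
by rewrite in_setC !(mem_below _ xc) in_setC.
Qed.

Lemma belowK I : tops (below I) = I.
Proof.
apply/setP => c; rewrite inE; have [x cx] := child_Some c.
have xc : @tle (ftree r) (Some x) (val c) by rewrite cx tlexx.
apply/exists_inP/idP => [[y yI]|cI].
  by rewrite cx => /eqP[yx]; rewrite -(mem_below I xc) yx.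
by exists x; rewrite ?(mem_below I xc) ?cx.
Qed.

Lemma topsK U : closed_in U r -> below (tops U) = U.
Proof.
move=> /closed_inP Ucl; apply/setP => x; have [c xc] := forest_child r x.
rewrite (mem_below _ xc) inE; have [y cy] := child_Some c; rewrite cy.
rewrite cy in xc; rewrite (Ucl _ _ xc).
by apply/exists_inP/idP => [[z zU /eqP[->]] //|yU]; exists y.
Qed.

Lemma Bplus_below I :
  isomorphic (Bplus_children I) (ftree (pull_to (below I) r)).
Proof.
set B := Bplus_children I.
pose F (x : B) : ftree (pull_to (below I) r) :=
  (* [insub] retypes a vertex as an element of [below I]; [pS] shows that it succeeds on every
     branch vertex. *)
  if x is inr p then obind insub (val (tagged p) : option T) else None.
have pS (p : {c : {c : child (ftree r) | c \in I} & downset (val (val c))}) :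
    exists2 x : {x | x \in below I}, val (tagged p) = Some (val x) & F (inr p) = Some x.
  case e : (val (tagged p)) => [x|]; last first.
    by have := child_nroot (valP (val (tag p))) (valP (tagged p)); rewrite e ftree_root.
  have xI : x \in below I.
    rewrite (@mem_below _ _ (val (tag p))) ?(valP (tag p)) //.
    by rewrite -e; apply: (valP (tagged p)).
  by exists (exist _ x xI) => //; rewrite /F e /= insubT.
apply: (@surj_mono_isomorphic B _ F).
  move=> [a|p] [b|s]; last first.
  - rewrite tle_downsets; [|by move=> c d /val_inj/val_inj|by move=> c; apply: valP].
    have [[x px ->] [y sy ->]] := (pS p, pS s); rewrite px sy.
    exact: pullE.
  - by have [x px ->] := pS p.
  - by have [x px ->] := pS s.
  - by [].
move=> [x|]; last by exists (inl tt).
have /exists_inP[c cI xc] : [exists c in I, @tle (ftree r) (Some (val x)) (val c)].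
  by have := valP x; rewrite inE.
pose E (c : {c : child (ftree r) | c \in I}) : Type := downset (val (val c)).
pose i : {c : child (ftree r) | c \in I} := exist _ c cI.
exists (inr (Tagged E (exist _ (Some (val x)) xc : E i))).
by rewrite /F /= valK.
Qed.

Lemma sum_branches (M : nmodType) (H : rtree -> rtree -> M) :
  \sum_(I : {set child (ftree r)})
     H (rtree_of (Bplus_children I)) (rtree_of (Bplus_children (~: I))) =
  \sum_(U | closed_in U r)
     H (rtree_of (ftree (pull_to U r))) (rtree_of (ftree (pull_to (~: U) r))).
Proof.
rewrite [RHS](reindex_onto below tops) /=; last by move=> U; apply: topsK.
apply: eq_big => I; first by rewrite below_closed belowK eqxx.
move=> _; congr H; apply/rtree_of_iso; first exact: Bplus_below.
by rewrite -belowC; apply: Bplus_below.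
Qed.

End Branches.

(** * The coproduct of kappa and its products with corollas *)

Section KappaIdentities.
Variables (k : fieldType) (hk : [pchar k] =i pred0).

Lemma linext_linear (B : choiceType) (V : lmodType k) (L : {linear {malg k[B]} -> V}) x :
  linext (fun b => L << b >>) x = L x.
Proof.
rewrite {2}(monalgE x) linear_sum /linext; apply: eq_bigr => b _.
rewrite -linearZ /=; congr (L _); apply/malgP => c.
by rewrite mcoeffZ !mcoeffU mulr_natr.
Qed.

(** The divided-power formula, tested against the bilinear extension of an arbitrary [H] instead of
    being stated with tensors. A subset of size [i] contributes [i! (n - i)!] times the [i]-th term,
    and there are C(n, i) of them, which cancels the prefactor [1/n!]. *)
Lemma linext_coprod_kappa (M : lmodType k) (H : rtree -> rtree -> M) n :
  linext (fun p => H p.1 p.2) (coprod (kappa k n)) =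
  \sum_(i < n.+1) linext (fun t => linext (H t) (kappa k (n - i))) (kappa k i).
Proof.
pose T : finType := 'I_n.
pose G i := linext (fun t => linext (H t) (kappa k (n - i))) (kappa k i).
have nz m : (m`!)%:R != 0 :> k := natr_fact_neq0 hk m.
have term (U : {set T}) :
    \sum_(r : forest {x | x \in U}) \sum_(s : forest {x | x \in ~: U})
       H (rtree_of (ftree r)) (rtree_of (ftree s)) =
    ((#|U|)`! * (n - #|U|)`!)%:R *: G #|U|.
  have c1 : #|{: {x | x \in U}}| = #|U| by rewrite card_sig.
  have c2 : #|{: {x | x \in ~: U}}| = (n - #|U|)%N.
    by rewrite card_sig -[n in RHS]card_ord -(cardsC U) addKn.
  have Gs t : linext (H t) (kappa k (n - #|U|)) =
      ((n - #|U|)`!%:R)^-1 *: \sum_(s : forest {x | x \in ~: U}) H t (rtree_of (ftree s)).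
    by rewrite -c2 (linext_kappa hk).
  have Gr : G #|U| = ((#|U|)`!%:R)^-1 *: \sum_(r : forest {x | x \in U})
      linext (H (rtree_of (ftree r))) (kappa k (n - #|U|)).
    have := linext_kappa hk (fun t => linext (H t) (kappa k (n - #|U|))) {x | x \in U}.
    by rewrite c1.
  rewrite Gr natrM scalerA mulrAC divff ?nz // mul1r.
  rewrite scaler_sumr; apply: eq_bigr => r _.
  by rewrite Gs scalerA divff ?nz // scale1r.
rewrite /coprod -{1}(card_ord n) (linext_kappa hk) card_ord linearZ /=.
rewrite [linext _ _]linear_sum /=.
under eq_bigr => r _.
  rewrite coprodT_rtree_of [linext _ _]linear_sum /=.
  under eq_bigr => I _ do rewrite linextU /=.
  rewrite (sum_branches r H).
over.
(* With [U] fixed first, the orders in which [U] is closed are the pairs of orders on [U] and on its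
   complement. *)
rewrite (exchange_big_dep predT) //=.
under eq_bigr => U _.
  rewrite (sum_closed_in (fun r s => H (rtree_of (ftree r)) (rtree_of (ftree s)))) term.
over.
have Ule (U : {set T}) : (#|U| < n.+1)%N by rewrite ltnS -[n in (_ <= n)%N]card_ord max_card.
rewrite (partition_big (fun U : {set T} => Ordinal (Ule U)) predT) //= scaler_sumr.
apply: eq_bigr => i _; rewrite (eq_bigr (fun _ => (i`! * (n - i)`!)%:R *: G i)); last first.
  by move=> U /eqP <-.
rewrite sumr_const -scaler_nat !scalerA.
have -> : #|[pred U : {set T} | Ordinal (Ule U) == i]| = 'C(n, i).
  have := card_draws T i; rewrite card_ord => <-.
  by apply: eq_card => U; rewrite !inE -val_eqE.
by rewrite -mulrA -natrM bin_fact -1?ltnS // mulVf ?nz // scale1r.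
Qed.

Lemma convolution_id_kappa (S : {linear kT k -> kT k}) n :
  convolution id S (kappa k n) =
  \sum_(i < n.+1) gl (kappa k i) (S (kappa k (n - i))).
Proof.
rewrite /convolution (linext_coprod_kappa (fun t t' => gl << t >> (S << t' >>))).
apply: eq_bigr => i _; rewrite /gl; congr (linext _ _); apply/funext => t.
under [X in linext X]functional_extensionality_dep => t' do rewrite linextU.
exact: (linext_linear (linext (glT k t) \o S)).
Qed.

(** The closed form of [epsilon k n], as confirmed in [epsilon_corolla]. *)
Definition corolla n : kT k := (n`!%:R)^-1 *: << tpart (ones n) >>.

Lemma glE (x y : kT k) :
  gl x y = \sum_(t <- msupp x) x@_t *: linext (glT k t) y.
Proof. by []. Qed.

Lemma glZr (x y : kT k) a : gl x (a *: y) = a *: gl x y.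
Proof.
rewrite !glE scaler_sumr; apply: eq_bigr => t _.
by rewrite linearZ !scalerA mulrC.
Qed.

(** By [sum_glT_ones], each [m]-subset [J] accounts for [(n - m)!] times the product with the
    unscaled corolla. Summed over all [J], an order [r] is met once for each [m]-subset of
    [maxs r]. *)
Lemma gl_kappa_corolla n m : (m <= n)%N ->
  gl (kappa k (n - m)) (corolla m) =
  (n`!%:R)^-1 *:
    \sum_(r : forest 'I_n) ('C(#|maxs r|, m))%:R *: << rtree_of (ftree r) >>.
Proof.
move=> mn; pose T : finType := 'I_n.
have nz j : (j`!)%:R != 0 :> k := natr_fact_neq0 hk j.
have term (J : {set T}) : #|J| = m ->
    \sum_(r : forest T | J \subset maxs r) << rtree_of (ftree r) >> =
    ((n - m)`!)%:R *: gl (kappa k (n - m)) << tpart (ones m) >>.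
  move=> Jm; have c1 : #|{: {x | x \in ~: J}}| = (n - m)%N.
    by rewrite card_sig -Jm -[n in RHS]card_ord -(cardsC J) addKn.
  rewrite /gl -{2}c1 (linext_kappa hk) c1 scalerA divff ?nz // scale1r.
  rewrite -[J in LHS]setCK -sum_glT_ones setCK Jm.
  by apply: eq_bigr => q _; rewrite linextU.
have -> : \sum_(r : forest T) ('C(#|maxs r|, m))%:R *: << rtree_of (ftree r) >> =
    \sum_(J : {set T} | #|J| == m)
       \sum_(r : forest T | J \subset maxs r) (<< rtree_of (ftree r) >> : kT k).
  rewrite (exchange_big_dep predT) //=; apply: eq_bigr => r _.
  rewrite sumr_const -scaler_nat -cards_draws; congr (_%:R *: _).
  by apply: eq_card => J; rewrite !inE andbC.
rewrite (eq_bigr (fun _ => ((n - m)`!)%:R *: gl (kappa k (n - m)) << tpart (ones m) >>)).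
  rewrite sumr_const -scaler_nat /corolla glZr !scalerA.
  have -> : #|[pred J : {set T} | #|J| == m]| = 'C(n, m).
    have := card_draws T m; rewrite card_ord => <-.
    by apply: eq_card => U; rewrite !inE.
  (* The scalars agree because [C(n, m) m! (n - m)! = n!]. *)
  congr (_ *: _); apply: (mulfI (nz m)); rewrite divff ?nz //.
  by rewrite mulrCA -!natrM mulnCA bin_fact // mulVf ?nz.
by move=> J /eqP; apply: term.
Qed.

End KappaIdentities.

(** * The recursion for epsilon and the three assertions *)

Section Epsilon.
Variables (k : fieldType) (hk : [pchar k] =i pred0).

(** Pascal's rule splits the leading term; the remaining terms are minus the sum for [n], so the
    induction hypothesis cancels one half. *)
Lemma alt_sum_bin M n :
  \sum_(i < n.+1) (-1) ^+ i * ('C(M.+1, n - i))%:R = ('C(M, n))%:R :> k.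
Proof.
elim: n => [|n IH]; first by rewrite big_ord1 mul1r !bin0.
rewrite big_ord_recl expr0 mul1r subn0 binS natrD.
under eq_bigr => i _ do rewrite /= subSS exprS -mulrA.
by rewrite -mulr_sumr IH mulN1r addrK.
Qed.

(** The child of the root above [ord0] is maximal. Positivity gives the upper index the successor
    form of [alt_sum_bin]; for upper index 0 the alternating sum would be a sign. *)
Lemma maxs_gt0 n (r : forest 'I_n.+1) : (0 < #|maxs r|)%N.
Proof.
have [c _] := forest_child r ord0; have [x cx] := child_Some c.
apply/card_gt0P; exists x; apply/maxsP/ftree_childP; rewrite -cx; exact: valP.
Qed.

Lemma point_discrete0 : rtree_of point = tpart (ones 0).
Proof.
rewrite -[in RHS](card_ord 0) -rtree_of_discrete; apply: rtree_of_iso.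
apply: (@surj_mono_isomorphic point (ftree (discrete 'I_0)) (fun _ => None)).
  by move=> [] [].
by move=> [[]|] //; exists tt.
Qed.

Lemma corolla0 : corolla k 0 = << bullet >>.
Proof. by rewrite /corolla fact0 invr1 scale1r -point_discrete0. Qed.

(** The case [m = 0] of [gl_kappa_corolla], where every binomial is 1. *)
Lemma gl_kappa_bullet n : gl (kappa k n) << bullet >> = kappa k n.
Proof.
rewrite -corolla0 -[in LHS](subn0 n) (gl_kappa_corolla hk) //.
rewrite -[n in RHS]card_ord (kappaE hk) card_ord.
by congr (_ *: _); apply: eq_bigr => r _; rewrite bin0 scale1r.
Qed.

(** The binomial vanishes unless all [n] vertices are maximal, which forces the discrete order. This
    form allows comparison with [gl_kappa_corolla] coefficient by coefficient. *)
Lemma corollaE n :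
  corolla k n = (n`!%:R)^-1 *:
    \sum_(r : forest 'I_n) ('C(#|maxs r|, n))%:R *: << rtree_of (ftree r) >>.
Proof.
rewrite /corolla; congr (_ *: _); rewrite (bigD1 (discrete 'I_n)) //=.
have md : maxs (discrete 'I_n) = setT.
  by apply/setP => x; rewrite in_setT; apply/maxsP => y; rewrite discreteE => /eqP.
rewrite md cardsT card_ord binn scale1r rtree_of_discrete card_ord.
rewrite big1 ?addr0 // => r rd; rewrite bin_small ?scale0r //.
rewrite -[X in (_ < X)%N]card_ord -cardsT; apply: proper_card; rewrite properT.
apply: contra rd => /eqP rT; apply/eqP/fle_ext => x y; rewrite discreteE.
apply/idP/eqP => [|->]; last exact: flexx.
by have /maxsP h : x \in maxs r by [rewrite rT inE]; move/h.
Qed.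

Lemma corollaS n :
  corolla k n.+1 =
    \sum_(i < n) (-1) ^+ i *: gl (kappa k i.+1) (corolla k (n - i))
    + (-1) ^+ n *: kappa k n.+1.
Proof.
(* The last term becomes a product with [corolla k 0], so that one sum covers all indices up to
   [n]. *)
have -> : kappa k n.+1 = gl (kappa k n.+1) (corolla k (n - n)).
  by rewrite subnn corolla0 gl_kappa_bullet.
transitivity (\sum_(i < n.+1) (-1) ^+ i *: gl (kappa k i.+1) (corolla k (n - i)));
  last by rewrite big_ord_recr.
rewrite corollaE.
have term (i : 'I_n.+1) : (-1) ^+ i *: gl (kappa k i.+1) (corolla k (n - i)) =
    (n.+1`!%:R)^-1 *: \sum_(r : forest 'I_n.+1)
      ((-1) ^+ i * ('C(#|maxs r|, n - i))%:R) *: << rtree_of (ftree r) >>.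
  have -> : i.+1 = (n.+1 - (n - i))%N.
    by rewrite subSn ?leq_subr // subKn // -ltnS.
  rewrite (gl_kappa_corolla hk); last exact: leq_trans (leq_subr _ _) (leqnSn n).
  rewrite scalerA mulrC -scalerA; congr (_ *: _); rewrite scaler_sumr.
  by apply: eq_bigr => r _; rewrite scalerA.
rewrite (eq_bigr _ (fun i _ => term i)) -scaler_sumr exchange_big; congr (_ *: _).
apply: eq_bigr => r _; rewrite -scaler_suml; congr (_ *: _).
have rle : (#|maxs r| <= n.+1)%N by have := max_card (mem (maxs r)); rewrite card_ord.
have := maxs_gt0 r; case: (#|maxs r|) rle => // M; rewrite ltnS => Mn _.
(* With [M.+1] maximal vertices the alternating sum is C(M, n); Pascal's rule leaves C(M, n+1),
   which is zero because [M <= n]. *)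
rewrite alt_sum_bin binS; move: Mn; rewrite leq_eqVlt => /orP[/eqP->|Mn].
  by rewrite binn bin_small.
by rewrite !bin_small // ltnW.
Qed.

Lemma epsilon_corolla n : epsilon k n = corolla k n.
Proof.
elim/ltn_ind: n => -[|n] IH; first by rewrite corolla0 epsilon0.
rewrite epsilonS corollaS; apply: (f_equal2 +%R); last by [].
by apply: eq_bigr => i _; rewrite IH // ltnS leq_subr.
Qed.

(** The one-vertex tree has no branches, so there is exactly one attaching map and it adds nothing
    to [t]. *)
Lemma glT_bullet (t : rtree) : glT k bullet t = << t >>.
Proof.
rewrite -{1}(rtree_ofK t) glT_rtree_of.
have nc (c : child point) : False.
  by have /childP[h _] := valP c; apply: h; case: (val c); case: (troot).
rewrite (big_pred1 [ffun _ => troot]); last first.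
  by move=> f; symmetry; apply/eqP/ffunP => c; case: (nc c).
congr << _ >>; rewrite -[RHS]rtree_ofK; apply/esym/rtree_of_iso.
set A := attach _ _; apply: (@surj_mono_isomorphic t A inl) => //.
by move=> [a|[c]]; [exists a|case: (nc c)].
Qed.

Lemma gl_bullet (x : kT k) : gl << bullet >> x = x.
Proof.
rewrite /gl linextU -[RHS](linext_linear idfun x).
by congr (linext _ x); apply/funext => t; rewrite glT_bullet.
Qed.

Lemma kappa0 : kappa k 0 = << bullet >>.
Proof.
rewrite -[X in kappa k X](card_ord 0) (kappaE hk) card_ord fact0 invr1 scale1r.
rewrite (big_pred1 (discrete 'I_0)) ?rtree_of_discrete ?card_ord ?point_discrete0 //.
  by rewrite -point_discrete0.
by move=> r; symmetry; apply/eqP/fle_ext => -[].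
Qed.

Lemma counit_kappaS n : counit (kappa k n.+1) = 0.
Proof.
rewrite /counit /kappa raddf_sum big_seq big1 // => t.
rewrite in_trees /= mcoeffZ mcoeffU => ct.
case: eqP => [tb|]; last by rewrite mulr0.
by move: ct; rewrite tb (isomorphic_card (rep_rtree_of _)) card_unit.
Qed.

Lemma scale_sign_eq0 (V : lmodType k) n (F : 'I_n -> V) (x y : V) :
  x + (\sum_i F i + y) = 0 ->
  (-1) ^+ n.+1 *: x = \sum_i (-1) ^+ n *: F i + (-1) ^+ n *: y.
Proof.
move=> /eqP; rewrite addr_eq0 => /eqP ->.
by rewrite exprS mulN1r scaleNr scalerN opprK scalerDr scaler_sumr.
Qed.

(** The counit kills kappa in positive degree. The [i = 0] term of the convolution is then
    [S (kappa k n.+1)], and the others are the products of the recursion for epsilon. *)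
Lemma antipode_kappa (S : {linear kT k -> kT k}) (n : nat) :
  is_antipode S -> epsilon k n = (-1) ^+ n *: S (kappa k n).
Proof.
move=> SP; have conv m : \sum_(i < m.+1) gl (kappa k i) (S (kappa k (m - i))) =
    counit (kappa k m) *: << bullet >>.
  by rewrite -(convolution_id_kappa hk) (SP _).2.
have S0 : S (kappa k 0) = << bullet >>.
  have := conv 0; rewrite big_ord1 subnn {1 3}kappa0 gl_bullet.
  by rewrite /counit mcoeffUU scale1r.
elim/ltn_ind: n => -[|n] IH; first by rewrite expr0 scale1r S0 epsilon0.
have rec : S (kappa k n.+1) +
    (\sum_(i < n) gl (kappa k i.+1) (S (kappa k (n - i))) + kappa k n.+1) = 0.
  have := conv n.+1; rewrite counit_kappaS scale0r big_ord_recl big_ord_recr /=.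
  by rewrite subn0 kappa0 gl_bullet subSS subnn S0 gl_kappa_bullet.
rewrite (scale_sign_eq0 rec) epsilonS; apply: (f_equal2 +%R); last by [].
(* The induction hypothesis brings the sign [(-1)^(n - i)], which combines with [(-1)^i] into a sign
   independent of [i]. *)
have sgn (i : 'I_n) : (-1) ^+ i *: gl (kappa k i.+1) (epsilon k (n - i)) =
    (-1) ^+ n *: gl (kappa k i.+1) (S (kappa k (n - i))).
  have iS : (n - i < n.+1)%N by rewrite ltnS leq_subr.
  have E : (i + (n - i) = n)%N by rewrite subnKC // ltnW.
  by rewrite (IH _ iS) glZr scalerA -exprD E.
exact: eq_bigr (fun i _ => sgn i).
Qed.

(** The symmetry number [n!] of the corolla, supplied by [phistar], cancels the denominator of
    [corolla]. *)
Lemma phistar_epsilon n : phistar (epsilon k n) = esymf k n.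
Proof.
rewrite epsilon_corolla /phistar /corolla linearZ /= linextU phistarT_tpart.
by rewrite card_Symm_tpart_ones scalerA mulVf ?scale1r // natr_fact_neq0.
Qed.

Lemma fact_epsilon n : (n`!)%:R *: epsilon k n = << tpart (ones n) >>.
Proof. by rewrite epsilon_corolla scalerA divff ?scale1r // natr_fact_neq0. Qed.

End Epsilon.

Theorem proposition6p1 (k : fieldType) (hk : [pchar k] =i pred0) :
  (forall S : {linear kT k -> kT k}, is_antipode S ->
     forall n : nat, epsilon k n = (-1) ^+ n *: S (kappa k n)) /\
  (forall n : nat, phistar (epsilon k n) = esymf k n) /\
  (forall n : nat, (n`!)%:R *: epsilon k n = << tpart (ones n) >>).
Proof.
split; first by move=> S SP n; apply: antipode_kappa.
by split=> n; [apply: phistar_epsilon|apply: fact_epsilon].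
Qed.
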